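(* Let $\Pi$ be a projective plane of order $10$ and let $C \subseteq (\mathbb{Z}/2\mathbb{Z})^{111}$ be the binary code generated by the rows of an incidence matrix of $\Pi$. Then $C$ contains no code word of weight $15$; that is, $A_{15}=0$, where $A_{15}$ denotes the number of code words of weight $15$ in $C$.
   Context: A projective plane of order $n\ge 2$ is a finite set of points together with lines (sets of points) such that every line contains $n+1$ points, every point lies on $n+1$ lines, any two distinct lines meet in a unique point, and any two distinct points lie on a unique line. It has $n^2+n+1$ points and $n^2+n+1$ lines. Its incidence matrix has rows indexed by lines and columns indexed by points, with entry $1$ if the line contains the point and $0$ otherwise. The code generated by the plane is the $\mathbb{Z}/2\mathbb{Z}$-span of the rows of the incidence matrix; its elements are called code words. The weight of a code word is its number of nonzero entries. *)

(* Defs.v *)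
From mathcomp Require Import all_boot all_algebra.

Set Implicit Arguments.
Unset Strict Implicit.
Unset Printing Implicit Defensive.

Import GRing.Theory.
Local Open Scope ring_scope.

(* The remaining axioms also hold for the empty set of points with the empty  *)
(* set of lines; [plane_point_gt0] excludes that degenerate structure, in     *)
(* accordance with the count of n ^ 2 + n + 1 points.                         *)
Record projective_plane (n : nat) := ProjectivePlane {
  plane_point : finType;
  plane_lines : {set {set plane_point}};
  plane_order_gt1 : (1 < n)%N;
  plane_point_gt0 : (0 < #|plane_point|)%N;
  plane_card_line : forall l, l \in plane_lines -> #|l| = n.+1;
  plane_card_pencil : forall p : plane_point,
    #|[set l in plane_lines | p \in l]| = n.+1;
  plane_meet : forall l m, l \in plane_lines -> m \in plane_lines -> l != m ->
    exists! p, p \in l :&: m;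
  plane_join : forall p q : plane_point, p != q ->
    exists! l, [/\ l \in plane_lines, p \in l & q \in l]
}.

(* [M] is an incidence matrix of [Pi] with respect to some ordering [l] of    *)
(* the lines (indexing the rows) and some ordering [p] of the points          *)
(* (indexing the columns).                                                    *)
Definition incidence_matrix (n : nat) (Pi : projective_plane n) (a b : nat)
    (M : 'M['F_2]_(a, b)) : Prop :=
  exists (l : 'I_a -> {set plane_point Pi}) (p : 'I_b -> plane_point Pi),
    [/\ injective l, [set l i | i : 'I_a] = plane_lines Pi, bijective p
      & forall i j, M i j = (p j \in l i)%:R].

Definition code (a b : nat) (M : 'M['F_2]_(a, b)) : {set 'rV['F_2]_b} :=
  [set v | (v <= M)%MS].

Definition weight (b : nat) (v : 'rV['F_2]_b) : nat := #|[set j | v 0 j != 0]|.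

Definition weight_count (b : nat) (C : {set 'rV['F_2]_b}) (w : nat) : nat :=
  #|[set v in C | weight v == w]|.

(* Main.v *)
(* Let S be the support of a code word of weight 15. Every line meets S in an *)
(* odd number of points, at most 5, and counting flags shows that there are   *)
(* exactly six 5-secants ("heavy" lines) H_0, .., H_5 and that S consists of  *)
(* the 15 points H_i /\ H_j. A line through {i,j} and {k,l}, with i, j, k, l  *)
(* distinct, also contains the point of the complementary pair; so the        *)
(* 3-secants correspond to the 15 perfect matchings of {0, .., 5}. Two        *)
(* disjoint matchings give a "hexagon" point off S where two 3-secants meet,  *)
(* and that point lies on no further 3-secant and on no heavy line. Each line *)
(* meeting S only in {i,j} meets the 12 3-secants that avoid {i,j} in six     *)
(* hexagon points, and thereby determines a "block": a partition of the 12    *)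
(* matchings avoiding {i,j} into six disjoint pairs. For each pair {i,j} the  *)
(* realized blocks partition the 36 hexagons avoiding {i,j}, and blocks       *)
(* realized for different pairs share at most one hexagon. An exhaustive      *)
(* search, with S_6 acting on the labels, shows that this is impossible for   *)
(* the pairs {0,1}, {2,3}, {4,5}, {2,4} together.                             *)

Require Import Defs.
From mathcomp Require Import all_boot all_algebra zify.

Set Implicit Arguments.
Unset Strict Implicit.
Unset Printing Implicit Defensive.

(** * Binary tries *)

(** Modulo 2, the support of a code word has the same intersection size with every point set that
    meets all lines oddly ([codeword_sum]). Since 10 is even, the whole plane and each line are such
    sets, so a support [S] of 15 points meets every line oddly. Call |l /\ S| - 1 the excess of a
    line l. The excesses of the lines through a point total 4 off [S] and 14 on [S]. This bounds
    secants by 5, and second moments give [card_heavy] and [card_heavy_pencil]: [S] is the vertex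
    set of six heavy lines.

    The total 4 off [S] also controls the 3-secants: off [S] they meet exactly two at a time
    ([tline_meet], [tline_partner]). A line joining the vertex {0,1} to a hexagon point therefore
    pairs off the twelve 3-secants avoiding {0,1}, and this pairing is its block ([real_cover],
    [real_disjoint], [real_compat]).

    What remains is finite: for each of four pairs, an exact cover of 36 cells by blocks, where
    blocks of different pairs share at most one cell. [search_sound] shows that the search overlooks
    no configuration, [refute_sound] eliminates blocks orbit by orbit, and [refute_true] is the
    computation. The soundness argument sees the plane only through abstract labellings;
    [no_odd_15set] supplies its hypotheses. *)

Inductive trie (A : Type) := Emp | Leaf of A | Node of trie A & trie A.
Arguments Emp {A}.

Fixpoint get A (t : trie A) (p : seq bool) : option A :=
  match t, p with
  | Leaf x, [::] => Some x
  | Node l r, b :: p' => get (if b then r else l) p'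
  | _, _ => None
  end.

(** Collapsing two empty children keeps [Emp] as the form of an emptied set, which the final test of
    [refute] looks for. *)
Definition node A (l r : trie A) : trie A :=
  match l with
  | Emp => match r with Emp => Emp | _ => Node l r end
  | _ => Node l r
  end.

(** Tries act as sets of paths. Only the payload of the first argument survives, so one [trie unit]
    can restrict tries carrying any data. *)
Fixpoint inter A B (a : trie A) (b : trie B) {struct a} : trie A :=
  match a, b with
  | Leaf _, Leaf _ => a
  | Node l r, Node l' r' => node (inter l l') (inter r r')
  | _, _ => Emp
  end.

Fixpoint diff A B (a : trie A) (b : trie B) {struct a} : trie A :=
  match b with
  | Emp => a
  | Leaf _ => match a with Leaf _ => Emp | _ => a end
  | Node l' r' => match a with
                  | Node l r => node (diff l l') (diff r r')
                  | _ => a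
                  end
  end.

Fixpoint tmap A B (f : A -> B) (t : trie A) : trie B :=
  match t with
  | Emp => Emp
  | Leaf x => Leaf (f x)
  | Node l r => Node (tmap f l) (tmap f r)
  end.

Fixpoint tfilter A (f : A -> bool) (t : trie A) : trie unit :=
  match t with
  | Emp => Emp
  | Leaf x => if f x then Leaf tt else Emp
  | Node l r => node (tfilter f l) (tfilter f r)
  end.

Fixpoint telems A (t : trie A) (acc : seq A) : seq A :=
  match t with
  | Emp => acc
  | Leaf x => x :: acc
  | Node l r => telems l (telems r acc)
  end.

Fixpoint first A (t : trie A) : option A :=
  match t with
  | Emp => None
  | Leaf x => Some x
  | Node l r => match first l with None => first r | x => x end
  end.

Fixpoint build A (n : nat) (s : seq A) : trie A * seq A :=
  match n with
  | 0 => match s with [::] => (Emp, [::]) | x :: s' => (Leaf x, s') end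
  | n'.+1 => let (l, s1) := build n' s in
             let (r, s2) := build n' s1 in (node l r, s2)
  end.

Lemma get_node A (l r : trie A) p : get (node l r) p = get (Node l r) p.
Proof. by case: l => [|x|l1 l2] //; case: r => //; case: p => // -[]. Qed.

Lemma get_inter A B (a : trie A) (b : trie B) p :
  get (inter a b) p = if get b p is Some _ then get a p else None.
Proof.
elim: a b p => [|x|l IHl r IHr] [|y|l' r'] [|c p] //=; rewrite ?get_node //=.
- by case: (get _ _).
- by case: (get _ _).
- by case: c.
Qed.

Lemma get_diff A B (a : trie A) (b : trie B) p :
  get (diff a b) p = if get b p is Some _ then None else get a p.
Proof.
elim: a b p => [|x|l IHl r IHr] [|y|l' r'] [|c p] //=; rewrite ?get_node //=.
- by case: (get _ _).
- by case: (get _ _).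
- by case: c.
Qed.

Lemma get_tmap A B (f : A -> B) (t : trie A) p :
  get (tmap f t) p = omap f (get t p).
Proof. by elim: t p => [|x|l IHl r IHr] [|[] p] /=. Qed.

Lemma get_tfilter A (f : A -> bool) (t : trie A) p :
  get (tfilter f t) p = if get t p is Some x then if f x then Some tt else None
                        else None.
Proof.
elim: t p => [|x|l IHl r IHr] [|b p] //=; rewrite ?get_node //=; try by case: (f x).
by case: b.
Qed.

Lemma all_telems A (P : A -> bool) t acc :
  all P (telems t acc) -> all P acc /\ forall p x, get t p = Some x -> P x.
Proof.
elim: t acc => [|x|l IHl r IHr] acc /=.
- by split=> // -[].
- by case/andP=> Px ?; split=> // -[|b p] //= y [<-].
- case/IHl=> /IHr[? gr] gl; split=> // -[|[] p] x //=; [exact: gr|exact: gl].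
Qed.

Lemma first_get A (t : trie A) x : first t = Some x -> exists p, get t p = Some x.
Proof.
elim: t => [|y|l IHl r IHr] //= => [[->]|]; first by exists [::].
case: (first l) IHl => [y IHl e|_ /IHr[p ?]]; last by exists (true :: p).
by have [p ?] := IHl e; exists (false :: p).
Qed.

(** [build n] has room for [2 ^ n] elements; the last clause shows that nothing is left over when
    [s] is no longer than that. *)
Lemma get_build (A : eqType) n (s : seq A) :
  (forall x, x \in s ->
     (exists p, get (build n s).1 p = Some x) \/ x \in (build n s).2) /\
  (forall p x, get (build n s).1 p = Some x -> x \in s) /\
  {subset (build n s).2 <= s} /\ size (build n s).2 = size s - 2 ^ n.
Proof.
elim: n s => [|n IHn] [|y s] /=.
- by split=> //; split=> // -[].
- rewrite subn1 /=; split=> [x|]; last split=> [[|? ?] x //= [<-]|].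
  + rewrite inE => /orP[/eqP->|]; last by right.
    by left; exists [::].
  + by rewrite mem_head.
  + by split=> // x xs; rewrite inE xs orbT.
all: set s0 := (s in build n s); have := IHn s0;
  case: (build n s0) => l s1 /= [A1 [B1 [C1 D1]]];
  have := IHn s1; case: (build n s1) => r s2 /= [A2 [B2 [C2 D2]]];
  (split=> [x /A1[[p gp]|/A2[[p gp]|]]|];
   [by left; exists (false :: p); rewrite get_node
   |by left; exists (true :: p); rewrite get_node | by right | ]);
  (split=> [p x|]; [rewrite get_node; case: p => // -[] p /=;
     [by move/B2/C1 | by move/B1] |]);
  (split; [by move=> x /C2/C1 | by rewrite D2 D1 expnS mul2n -addnn subnDA]).
Qed.

(** * Hexagons and blocks *)

Fixpoint matchings (n : nat) (s : seq nat) : seq (seq (nat * nat)) :=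
  match n, s with
  | n'.+1, i :: s' =>
      flatten [seq [seq (i, j) :: m | m <- matchings n' [seq k <- s' | k != j]]
              | j <- s']
  | _, _ => [:: [::]]
  end.

(* The 15 perfect matchings of {0, .., 5}, referred to by their index below.  *)
Definition pms : seq (seq (nat * nat)) := Eval vm_compute in matchings 3 (iota 0 6).

Definition disj (m m' : nat) : bool :=
  ~~ has (mem (nth [::] pms m)) (nth [::] pms m').

Definition ms0 : seq nat :=
  Eval vm_compute in [seq m <- iota 0 15 | (0, 1) \notin nth [::] pms m].

Definition sort2 (i j : nat) : nat * nat := if i < j then (i, j) else (j, i).

(* The 36 pairs of disjoint matchings that avoid {0,1}: they stand for the    *)
(* hexagon points not collinear with the point {0,1} on a 3-secant.           *)
Definition cells0 : seq (nat * nat) := Eval vm_compute in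
  [seq c <- [seq (i, j) | i <- ms0, j <- ms0] | (c.1 < c.2) && disj c.1 c.2].

(* Equal to 36 when {i, j} is not a cell. *)
Definition cidx (i j : nat) : nat := index (sort2 i j) cells0.

Fixpoint enum_blocks (n : nat) (s : seq nat) : seq (seq nat) :=
  match n, s with
  | n'.+1, i :: s' =>
      flatten [seq [seq cidx i j :: b | b <- enum_blocks n' [seq k <- s' | k != j]]
              | j <- [seq j <- s' | disj i j]]
  | _, _ => [:: [::]]
  end.

Definition blocks0 : seq (seq nat) := Eval vm_compute in enum_blocks 6 ms0.

(* Equal to 15 when [g] does not map [m] into a perfect matching. *)
Definition mimg (g : seq nat) (m : seq (nat * nat)) : nat :=
  find (fun m' => all (fun p => let i := nth 0 g p.1 in let j := nth 0 g p.2 in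
                                ((i, j) \in m') || ((j, i) \in m')) m) pms.

(** The value 36 marks a cell whose image is not a cell, for instance because an image matching
    contains {0,1}. *)
Definition cmap (g : seq nat) : seq nat :=
  let mm := [seq mimg g m | m <- pms] in
  [seq cidx (nth 0 mm c.1) (nth 0 mm c.2) | c <- cells0].

(** * The search *)

(** Fixes the path of each block once and for all: every set of blocks below is a trie over these
    paths. Depth 9 suffices because there are at most 512 blocks. *)
Definition blockt : trie (seq nat) := (build 9 blocks0).1.
Definition fullt : trie unit := tmap (fun _ => tt) blockt.
Definition cellts : seq (trie unit) :=
  [seq tfilter (fun b : seq nat => c \in b) blockt | c <- iota 0 36].
Definition cellt (c : nat) : trie unit := nth Emp cellts c.
Definition indext : trie nat := (build 6 (iota 0 36)).1.
Definition remt : trie (nat * trie unit) := tmap (fun c => (c, cellt c)) indext.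

(* What choosing a block entails: the cells it covers, the blocks of the same *)
(* pair disjoint from it, and, for each later pair, the blocks sharing at     *)
(* most one cell with it.                                                     *)
Record data := Data { dcells : trie unit; dself : trie unit; dcomps : seq (trie unit) }.

Fixpoint prs (s : seq nat) : seq (nat * nat) :=
  match s with [::] => [::] | x :: s' => map (pair x) s' ++ prs s' end.

(** Blocks containing the images of two cells of [b] are removed. A cell without image has index 36,
    where [cellt] is empty, so it removes nothing. *)
Definition compat (cm b : seq nat) : trie unit :=
  foldr (fun p t => diff t (inter (cellt (nth 36 cm p.1)) (cellt (nth 36 cm p.2))))
    fullt (prs b).

Definition selfc (b : seq nat) : trie unit :=
  foldr (fun c t => diff t (cellt c)) fullt b.

Definition mkdata (cms : seq (seq nat)) (b : seq nat) : data :=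
  Data (tfilter (fun c => c \in b) indext) (selfc b) [seq compat cm b | cm <- cms].

Definition branch
    (srch : trie data -> trie (nat * trie unit) -> seq (trie data) -> bool)
    (A : trie data) (rem : trie (nat * trie unit)) (rest : seq (trie data))
    (t : trie unit) : bool :=
  all (fun d => srch (inter A (dself d)) (diff rem (dcells d))
                  [seq inter p.1 p.2 | p <- zip rest (dcomps d)])
      (telems (inter A t) [::]).

(* [A] holds the blocks still possible for the current pair, [rem] its        *)
(* uncovered cells, and [rest] the possible blocks of the later pairs; [true] *)
(* means that the cells cannot all be covered.                                *)
Fixpoint search (n : nat) (A : trie data) (rem : trie (nat * trie unit))
    (rest : seq (trie data)) : bool :=
  match n with
  | 0 => false
  | n'.+1 =>
    match first rem with
    | None => match rest with
              | [::] => false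
              | A' :: rest' => search n' A' remt rest'
              end
    | Some (_, t) => branch (search n') A rem rest t
    end
  end.

Definition id6 : seq nat := iota 0 6.
Definition comp (h k : seq nat) : seq nat := [seq nth 0 h i | i <- k].

(* [gs] moves the pair {0,1} to {0,1}, {2,3}, {4,5} and {2,4}; already the     *)
(* blocks of these four pairs are contradictory. [kss] gives, for each of     *)
(* these relabellings g and each later h, the permutation h^-1 g.             *)
Definition gs : seq (seq nat) :=
  [:: id6; [:: 2; 3; 4; 5; 0; 1]; [:: 4; 5; 0; 1; 2; 3]; [:: 2; 4; 0; 1; 3; 5]].
Fixpoint transitions (s : seq (seq nat)) : seq (seq (seq nat)) :=
  match s with
  | [::] => [::]
  | g :: s' => [seq [seq index i h | i <- g] | h <- s'] :: transitions s'
  end.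
Definition kss : seq (seq (seq nat)) := Eval vm_compute in transitions gs.

Definition starts : seq (trie data) :=
  [seq tmap (mkdata [seq cmap k | k <- ks]) blockt | ks <- kss].

Definition stab01 : seq (seq nat) := Eval vm_compute in
  flatten [seq [:: [:: 0, 1 & p]; [:: 1, 0 & p]] | p <- permutations (iota 2 4)].
Definition stabmaps : seq (seq nat) := [seq cmap g | g <- stab01].

Definition containing (b : seq nat) (t : trie unit) : trie unit :=
  foldr (fun c t => inter t (cellt c)) t b.

Definition remove_orbit (b : seq nat) (t : trie unit) : trie unit :=
  foldr (fun cm t => diff t (containing [seq nth 36 cm c | c <- b] t)) t stabmaps.

(** [containing b fullt] forces [b] as the first block at {0,1}. Four pairs with six blocks each,
    and the changes of pair, fit within fuel 60; lack of fuel could only yield [false]. *)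
Definition refute_block (alive : trie unit) (b : seq nat) : bool :=
  match [seq inter A alive | A <- starts] with
  | A :: rest => branch (search 60) A remt rest (containing b fullt)
  | [::] => false
  end.

(* Once no labelling realizes the block [b], neither is any block of its      *)
(* orbit realized for any pair, so the whole orbit is dropped everywhere.     *)
Fixpoint refute (reps : seq nat) (alive : trie unit) : bool :=
  match reps with
  | [::] => match alive with Emp => true | _ => false end
  | i :: reps' => let b := nth [::] blocks0 i in
      [&& i < size blocks0, refute_block alive b
        & refute reps' (remove_orbit b alive)]
  end.

(** * Membership in the tries of blocks and cells *)

Lemma get_blockt b : b \in blocks0 -> exists p, get blockt p = Some b.
Proof.
have [A [_ [_ D]]] := get_build 9 blocks0.
by case/A=> // b_rest; move/eqP: D; rewrite size_eq0 => /eqP e; rewrite e in b_rest.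
Qed.

Lemma mem_blockt p b : get blockt p = Some b -> b \in blocks0.
Proof. by have [_ [B _]] := get_build 9 blocks0; apply: B. Qed.

Lemma get_cellt c p : get (cellt c) p <> None ->
  exists2 b, get blockt p = Some b & c \in b.
Proof.
rewrite /cellt; have [c36|c36] := ltnP c 36; last first.
  by rewrite nth_default ?size_map ?size_iota.
rewrite (nth_map 0) ?size_iota // nth_iota // add0n get_tfilter.
by case: (get blockt p) => // b; case: ifP => // cb _; exists b.
Qed.

Lemma get_cellt_mem c p b : c < 36 -> get blockt p = Some b -> c \in b ->
  get (cellt c) p = Some tt.
Proof.
move=> c36 gb cb; rewrite /cellt (nth_map 0) ?size_iota // nth_iota // add0n.
by rewrite get_tfilter gb cb.
Qed.

Lemma get_remt q c t : get remt q = Some (c, t) ->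
  [/\ get indext q = Some c, c < 36 & t = cellt c].
Proof.
rewrite get_tmap; case e: (get indext q) => [c'|] //= [<- <-]; split=> //.
by have [_ [B _]] := get_build 6 (iota 0 36); have := B _ _ e; rewrite mem_iota.
Qed.

Lemma blocks0_range b c : b \in blocks0 -> c \in b -> c < 36.
Proof.
have /allP h : all (all (fun c => c < 36)) blocks0 by vm_compute.
by move/h/allP; apply.
Qed.

Lemma blocks0_uniq b : b \in blocks0 -> uniq b.
Proof. have /allP h : all uniq blocks0 by vm_compute. exact: h. Qed.

Lemma prsP (s : seq nat) p : uniq s -> p \in prs s ->
  [/\ p.1 \in s, p.2 \in s & p.1 != p.2].
Proof.
elim: s => //= x s IH /andP[xs us]; rewrite mem_cat => /orP[/mapP[y ys ->]|ps].
  by rewrite !inE eqxx ys orbT; split=> //; apply: contraNneq xs => /= ->.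
by have [p1 p2 p12] := IH us ps; rewrite !inE p1 p2 !orbT.
Qed.

Lemma get_foldr_diff (I : eqType) (F : I -> trie unit) (s : seq I) (t : trie unit) p :
  get t p <> None -> (forall i, i \in s -> get (F i) p = None) ->
  get (foldr (fun i t => diff t (F i)) t s) p <> None.
Proof.
move=> tp; elim: s => //= i s IH Fs; rewrite get_diff Fs ?mem_head //.
by apply: IH => j js; apply: Fs; rewrite inE js orbT.
Qed.

Lemma get_fullt p b : get blockt p = Some b -> get fullt p <> None.
Proof. by move=> gb; rewrite get_tmap gb. Qed.

Lemma get_containing b t p : get (containing b t) p <> None ->
  get t p <> None /\ forall c, c \in b -> get (cellt c) p <> None.
Proof.
elim: b => [|c b IH] //=; rewrite get_inter.
case e: (get (cellt c) p) => [u|] // /IH[? h]; split=> // d.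
by rewrite inE => /orP[/eqP->|/h //]; rewrite e.
Qed.

Lemma get_containing_mem b t p b' : get blockt p = Some b' -> get t p <> None ->
  (forall c, c \in b -> c < 36 /\ c \in b') -> get (containing b t) p <> None.
Proof.
move=> gb' tp; elim: b => //= c b IH h; rewrite get_inter.
have [c36 cb'] := h c (mem_head _ _).
rewrite (get_cellt_mem c36 gb' cb'); apply: IH => d db.
by apply: h; rewrite inE db orbT.
Qed.

Lemma dcells_mkdata cms b :
  dcells (mkdata cms b) = tfilter (fun c : nat => c \in b) indext.
Proof. by []. Qed.

(** * Soundness of the search *)

(** The pair {0,1} of [act H k] is the pair {k 0, k 1} of [H]; the condition says that these are
    different pairs of heavy lines. *)
Definition moves01 (k : seq nat) : bool :=
  ~~ perm_eq [:: nth 0 k 0; nth 0 k 1] [:: 0; 1].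

Section Soundness.

(* [lab] stands for the labellings of the heavy lines, on which permutations  *)
(* of the labels act; [real H b] for: some line realizes the block [b] at the *)
(* pair {0,1} of [H].                                                         *)
Variables (lab : Type) (act : lab -> seq nat -> lab) (valid : lab -> Prop).
Variable real : lab -> seq nat -> Prop.

Hypothesis act1 : forall H, valid H -> act H id6 = H.
Hypothesis actM : forall H h k, valid H -> perm_eq h id6 -> perm_eq k id6 ->
  act (act H h) k = act H (comp h k).
Hypothesis valid_act : forall H k, valid H -> perm_eq k id6 -> valid (act H k).
Hypothesis real_cover : forall H, valid H -> forall c, c < 36 ->
  exists b, [/\ b \in blocks0, c \in b & real H b].
Hypothesis real_disjoint : forall H, valid H -> forall b b' c,
  b \in blocks0 -> b' \in blocks0 -> real H b -> real H b' ->
  c \in b -> c \in b' -> b = b'.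
Hypothesis real_compat : forall H k b b' c1 c2, valid H -> perm_eq k id6 ->
  moves01 k -> b \in blocks0 -> b' \in blocks0 -> real (act H k) b -> real H b' ->
  c1 \in b -> c2 \in b -> c1 != c2 ->
  nth 36 (cmap k) c1 \in b' -> nth 36 (cmap k) c2 \in b' -> False.
Hypothesis real_sym : forall H k b b', valid H -> perm_eq k id6 -> ~~ moves01 k ->
  b \in blocks0 -> b' \in blocks0 -> real H b' ->
  (forall c, c \in b -> nth 36 (cmap k) c \in b') -> real (act H k) b.

(** [Hs] are the labellings of the pairs treated later; [ks] carries cells of the current labelling
    to cells of each of them. *)
Definition linked (H : lab) (ks : seq (seq nat)) (Hs : seq lab) : Prop :=
  size ks = size Hs /\ forall i, i < size Hs ->
    [/\ H = act (nth H Hs i) (nth [::] ks i), perm_eq (nth [::] ks i) id6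
      & moves01 (nth [::] ks i)].

Definition covers (H : lab) (ks : seq (seq nat)) (A : trie data) : Prop :=
  forall p b, get blockt p = Some b -> real H b ->
    get A p = Some (mkdata [seq cmap k | k <- ks] b).

Inductive sound : seq lab -> seq (trie data) -> Prop :=
| sound_nil : sound [::] [::]
| sound_cons H Hs ks A As : valid H -> linked H ks Hs -> covers H ks A ->
    sound Hs As -> sound (H :: Hs) (A :: As).

Lemma sound_inter (H0 : lab) Hs As (ts : seq (trie unit)) :
  sound Hs As -> size ts = size Hs ->
  (forall i p b, i < size Hs -> get blockt p = Some b -> real (nth H0 Hs i) b ->
     get (nth Emp ts i) p <> None) ->
  sound Hs [seq inter p.1 p.2 | p <- zip As ts].
Proof.
move=> sA; elim: sA ts => [|H Hs' ks A As' vH lH cA sA' IH] [|t ts] //=.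
  by move=> _ _; apply: sound_nil.
move=> [sz] ht; apply: (@sound_cons _ _ ks) => //.
  move=> p b gb rb; rewrite get_inter; have := ht 0 p b isT gb rb.
  by case: (get _ _) => // _ _; apply: cA.
by apply: IH => // i p b; apply: (ht i.+1).
Qed.

Lemma get_compat H k b b' p : valid H -> perm_eq k id6 -> moves01 k ->
  b \in blocks0 -> get blockt p = Some b' -> real (act H k) b -> real H b' ->
  get (compat (cmap k) b) p <> None.
Proof.
move=> vH k6 k01 bb gb' rb rb'; apply: get_foldr_diff (get_fullt gb') _ => -[c1 c2].
case/prsP=> [|c1b c2b c12]; first exact: blocks0_uniq.
rewrite get_inter; case e2: (get _ _) => [[]|] //; case e1: (get _ _) => [[]|] //.
have [|d1 gd1 c1d] := @get_cellt (nth 36 (cmap k) c1) p; first by rewrite e1.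
have [|d2 gd2 c2d] := @get_cellt (nth 36 (cmap k) c2) p; first by rewrite e2.
move: gd1 gd2 c1d c2d; rewrite gb' => -[<-] [<-] c1d c2d.
by case: (@real_compat H k b b' c1 c2) => //; apply: mem_blockt gb'.
Qed.

(** The invariant of the recursion. [A] must retain only realized blocks that cover some uncovered
    cell, because a chosen block removes itself from [A]. *)
Definition refutes
    (srch : trie data -> trie (nat * trie unit) -> seq (trie data) -> bool) :=
  forall A rem rest H ks Hs,
  srch A rem rest -> valid H -> linked H ks Hs -> sound Hs rest ->
  (forall q x, get rem q = Some x -> get remt q = Some x) ->
  (forall p b q x, get blockt p = Some b -> real H b -> get rem q = Some x ->
     x.1 \in b -> get A p = Some (mkdata [seq cmap k | k <- ks] b)) ->
  False.

Lemma branch_sound srch A rem rest t H ks Hs p b :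
  refutes srch -> branch srch A rem rest t ->
  valid H -> linked H ks Hs -> sound Hs rest ->
  (forall q x, get rem q = Some x -> get remt q = Some x) ->
  (forall p b q x, get blockt p = Some b -> real H b -> get rem q = Some x ->
     x.1 \in b -> get A p = Some (mkdata [seq cmap k | k <- ks] b)) ->
  get blockt p = Some b -> real H b -> get t p <> None ->
  get A p = Some (mkdata [seq cmap k | k <- ks] b) -> False.
Proof.
move=> IH /all_telems[_ hb] vH [szk lH] sH hrem hA gp rb tp gA.
have bb := mem_blockt gp.
have := hb p (mkdata [seq cmap k | k <- ks] b).
rewrite get_inter gA; case: (get t p) tp => // _ _.
move=> /(_ erefl) srch'; apply: (IH _ _ _ _ _ _ srch' vH (conj szk lH)).
- apply: (@sound_inter H) => //; first by rewrite !size_map.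
  move=> i p' b' ltiH gb' rb'; have [eH k6 k01] := lH i ltiH.
  rewrite (nth_map [::]) ?size_map ?szk // (nth_map [::]) ?szk //.
  apply: (get_compat _ k6 k01 bb gb' _ rb'); last by rewrite -eH.
  elim: (sH) i ltiH {eH k6 k01 rb'} => // H' Hs' ? ? ? vH' _ _ _ IHs [|i] //=.
  exact: IHs.
- by move=> q' x; rewrite get_diff; case: (get (dcells _) _) => // /hrem.
- move=> p' b' q' [c' t'] gb' rb'; rewrite get_diff dcells_mkdata get_tfilter.
  case eq': (get rem q') => [x'|]; last by case: (get indext q') => // ?; case: ifP.
  have := hrem _ _ eq'; case: x' eq' => c2 t2 eq2 /get_remt[-> _ _].
  case: ifP => // c2b [<- _] c2b'; rewrite get_inter.
  have -> : get A p' = Some (mkdata [seq cmap k | k <- ks] b') by apply: hA eq2 _.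
  (* A realized block with a cell outside [b] differs from [b], hence is disjoint from it by
     [real_disjoint]. *)
  suff: get (selfc b) p' <> None by case: (get (selfc b) p').
  apply: get_foldr_diff (get_fullt gb') _ => d db.
  case ed: (get (cellt d) p') => [[]|] //.
  have [|b2 gb2 db2] := @get_cellt d p'; first by rewrite ed.
  move: gb2 db2; rewrite gb' => -[<-] db'.
  by rewrite (real_disjoint vH bb (mem_blockt gb') rb rb' db db') c2b' in c2b.
Qed.

(** The first uncovered cell lies in a realized block, which the invariant keeps in [A], so one of
    the branches follows the actual plane. Once all cells are covered, the next pair starts
    afresh. *)
Lemma search_sound n : refutes (search n).
Proof.
elim: n => // n IH A rem rest H ks Hs /=.
case e: (first rem) => [[c t]|]; last first.
  move=> + vH lH sH; case: sH => // H' Hs' ks' A' As' vH' lH' cA' sH' srch _ _.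
  apply: (IH _ _ _ _ _ _ srch vH' lH' sH') => // p b q x gb rb _ _.
  exact: cA'.
move=> srch vH lH sH hrem hA.
have [q gq] := first_get e; have [_ c36 et] := get_remt (hrem _ _ gq).
have [b [bb cb rb]] := real_cover vH c36.
have [p gp] := get_blockt bb.
apply: (branch_sound IH srch vH lH sH hrem hA gp rb); last exact: hA gp rb gq cb.
by rewrite et (get_cellt_mem c36 gp cb).
Qed.

Definition all_alive (alive : trie unit) : Prop :=
  forall H p b, valid H -> get blockt p = Some b -> real H b ->
    get alive p <> None.

(** The four labellings are [act H g] for [g] in [gs]; they are linked because g is the composite of
    h with h^-1 g. *)
Lemma starts_sound alive H : valid H -> all_alive alive ->
  exists A rest ks Hs, [/\ [seq inter A alive | A <- starts] = A :: rest,
    linked H ks Hs, covers H ks A & sound Hs rest].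
Proof.
move=> vH hal.
have cov ks g : perm_eq g id6 ->
    covers (act H g) ks (inter (tmap (mkdata [seq cmap k | k <- ks]) blockt) alive).
  move=> g6 p b gb rb; rewrite get_inter get_tmap gb /=.
  have := hal _ p b (valid_act vH g6) gb rb.
  by case: (get alive p).
have lnk g hs ks : size ks = size hs ->
    (forall i, i < size hs -> [/\ perm_eq (nth [::] hs i) id6,
       perm_eq (nth [::] ks i) id6, moves01 (nth [::] ks i)
       & comp (nth [::] hs i) (nth [::] ks i) = g]) ->
    linked (act H g) ks [seq act H h | h <- hs].
  move=> sz h; split=> [|i]; rewrite size_map // => ih.
  have [h6 k6 k01 <-] := h i ih; split=> //.
  by rewrite (nth_map [::]) // actM.
pose ksn i := nth [::] kss i.
pose An i := inter (tmap (mkdata [seq cmap k | k <- ksn i]) blockt) alive.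
exists (An 0), [:: An 1; An 2; An 3], (ksn 0), [seq act H h | h <- behead gs]; split.
- by [].
- by rewrite -[H in linked H](act1 vH); apply: lnk => // -[|[|[|?]]].
- by rewrite -[H in covers H](act1 vH); apply: cov.
apply: (@sound_cons (act H (nth [::] gs 1)) [seq act H h | h <- drop 2 gs] (ksn 1)).
- exact: valid_act.
- by apply: lnk => // -[|[|?]].
- exact: cov.
apply: (@sound_cons (act H (nth [::] gs 2)) [seq act H h | h <- drop 3 gs] (ksn 2)).
- exact: valid_act.
- by apply: lnk => // -[|?].
- exact: cov.
apply: (@sound_cons (act H (nth [::] gs 3)) [seq act H h | h <- drop 4 gs] (ksn 3)).
- exact: valid_act.
- by apply: lnk.
- exact: cov.
exact: sound_nil.
Qed.

Lemma refute_block_sound alive b H :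
  b \in blocks0 -> refute_block alive b -> all_alive alive -> valid H -> real H b ->
  False.
Proof.
move=> bb + hal vH rb; rewrite /refute_block.
have [A [rest [ks [Hs [-> lH cA sH]]]]] := starts_sound vH hal.
have [p gp] := get_blockt bb; move=> br.
apply: (branch_sound (@search_sound 60) br vH lH sH _ _ gp rb) => //.
- by move=> p' b' q x gb' rb' _ _; apply: cA.
- apply: (get_containing_mem gp (get_fullt gp)) => c cb.
  by split=> //; apply: blocks0_range bb cb.
- exact: cA.
Qed.

(** If a realized block contained the image of [b] under a stabilizing permutation, [real_sym] would
    realize [b] in the relabelling. *)
Lemma get_remove_orbit alive b H p b' : b \in blocks0 ->
  (forall H', valid H' -> ~ real H' b) -> valid H ->
  get blockt p = Some b' -> real H b' -> get alive p <> None ->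
  get (remove_orbit b alive) p <> None.
Proof.
move=> bb nb vH gb' rb' ap.
have stabP g : g \in stab01 -> perm_eq g id6 && ~~ moves01 g.
  have /allP h : all (fun g => perm_eq g id6 && ~~ moves01 g) stab01 by vm_compute.
  exact: h.
rewrite /remove_orbit /stabmaps; elim: stab01 stabP => //= g s IH stabP.
rewrite get_diff; case e: (get (containing _ _) p) => [u|]; last first.
  by apply: IH => k ks; apply: stabP; rewrite inE ks orbT.
have /andP[g6 g01] := stabP g (mem_head _ _).
case: (nb _ (valid_act vH g6)); apply: (real_sym vH g6 g01 bb _ rb').
  exact: mem_blockt gb'.
have ne : Some u <> None by [].
rewrite -e in ne; have [_ hc] := get_containing ne.
move=> c cb; have := hc _ (map_f _ cb) => /get_cellt[b2].
by rewrite gb' => -[<-].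
Qed.

Lemma refute_sound reps alive H :
  refute reps alive -> all_alive alive -> valid H -> False.
Proof.
elim: reps alive H => [|i reps IH] alive H /=.
  case: alive => // _ hal vH.
  (* Some realized block covers cell 0, so the set of surviving blocks cannot be empty. *)
  have [b [bb _ rb]] := @real_cover H vH 0 isT.
  by have [p gp] := get_blockt bb; apply: (hal H p b vH gp rb).
case/and3P=> ilt rbl rest hal vH.
have bb : nth [::] blocks0 i \in blocks0 by apply: mem_nth.
have nb H' : valid H' -> ~ real H' (nth [::] blocks0 i).
  by move=> vH' rb'; apply: refute_block_sound bb rbl hal vH' rb'.
apply: (IH _ H rest) => // H' p b' vH' gb' rb'.
exact: get_remove_orbit bb nb vH' gb' rb' (hal _ _ _ vH' gb' rb').
Qed.

Lemma no_realization H :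
  refute [:: 1; 3; 11; 2; 0; 8; 9; 13; 16; 17; 27; 32; 33; 183; 221] fullt ->
  ~ valid H.
Proof. by move=> h vH; apply: refute_sound h _ vH => ? p b _ /get_fullt. Qed.

End Soundness.

(* One block from each of the 15 orbits under the stabilizer of {0,1}, in an  *)
(* order that keeps the search small.                                         *)
Lemma refute_true :
  refute [:: 1; 3; 11; 2; 0; 8; 9; 13; 16; 17; 27; 32; 33; 183; 221] fullt.
Proof. by vm_cast_no_check (erefl true). Qed.

(** * Counting in projective planes *)

Section Plane.

Variables (n : nat) (Pi : projective_plane n).
Local Notation pt := (plane_point Pi).
Local Notation L := (plane_lines Pi).
Implicit Types (x y : pt) (l m : {set pt}) (S : {set pt}).

Lemma meet_inj l m x y : l \in L -> m \in L -> l != m ->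
  x \in l -> x \in m -> y \in l -> y \in m -> x = y.
Proof.
move=> lL mL lm xl xm yl ym; have [z [_ zu]] := plane_meet lL mL lm.
by rewrite -(zu x) ?inE ?xl // -(zu y) ?inE ?yl.
Qed.

Lemma meet_ex l m : l \in L -> m \in L -> exists2 x, x \in l & x \in m.
Proof.
move=> lL mL; have [<-|lm] := eqVneq l m.
  have /card_gt0P[x xl] : 0 < #|l| by rewrite (plane_card_line lL).
  by exists x.
by have [z [/setIP[zl zm] _]] := plane_meet lL mL lm; exists z.
Qed.

Lemma join_inj x y l m : x != y -> l \in L -> m \in L ->
  x \in l -> y \in l -> x \in m -> y \in m -> l = m.
Proof.
move=> xy lL mL xl yl xm ym; have [k [_ ku]] := plane_join xy.
by rewrite -(ku l) // -(ku m).
Qed.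

Lemma join_ex x y : exists l, [/\ l \in L, x \in l & y \in l].
Proof.
have [<-|xy] := eqVneq x y; last first.
  by have [k [? _]] := plane_join xy; exists k.
have : 0 < #|[set l in L | x \in l]| by rewrite plane_card_pencil.
by case/card_gt0P=> l; rewrite inE => /andP[? ?]; exists l.
Qed.

Lemma card_join x y : x != y -> #|[set l in L | (x \in l) && (y \in l)]| = 1.
Proof.
move=> xy; have [l [lL xl yl]] := join_ex x y.
apply/eqP/cards1P; exists l; apply/setP=> m; rewrite !inE.
apply/and3P/eqP => [[mL xm ym]|->//]; exact: join_inj xy mL lL xm ym xl yl.
Qed.

Lemma sum_mem_card (I : finType) (A : pred I) (F : I -> {set pt}) S :
  \sum_(i | A i) #|F i :&: S| = \sum_(x in S) #|[set i | A i & x \in F i]|.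
Proof.
transitivity (\sum_(i | A i) \sum_(x in S) (x \in F i : nat)).
  apply: eq_bigr => i _; rewrite -sum1_card big_mkcond [RHS]big_mkcond /=.
  by apply: eq_bigr => x _; rewrite !inE; case: (x \in S); case: (x \in F i).
rewrite exchange_big; apply: eq_bigr => x _.
rewrite -sum1_card big_mkcond [RHS]big_mkcond /=.
by apply: eq_bigr => i _; rewrite inE; case: (A i); case: (x \in F i).
Qed.

(** A point of [S] other than [x] is counted on one line, [x] itself on [n.+1]. *)
Lemma sum_pencil S x :
  \sum_(l in L | x \in l) #|l :&: S| = #|S| + (x \in S) * n.
Proof.
rewrite (sum_mem_card _ id) /=.
have E y : #|[set l | (l \in L) && (x \in l) & y \in l]| = 1 + (y == x) * n.
  have [->|yx] := eqVneq y x.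
    rewrite mul1n add1n -(plane_card_pencil x); apply: eq_card => l.
    by rewrite !inE; case: (l \in L); case: (x \in l).
  rewrite addn0 -(card_join (x := x) (y := y)) 1?eq_sym //.
  by apply: eq_card => l; rewrite !inE andbA.
rewrite (eq_bigr _ (fun y _ => E y)) big_split /= sum1_card -big_distrl /=.
congr (_ + _ * n); have [xS|xS] := boolP (x \in S).
  by rewrite (bigD1 x) //= eqxx big1 // => y /andP[_ /negPf->].
by rewrite big1 // => y yS; case: eqP => // e; rewrite -e yS in xS.
Qed.

Lemma sum_card_lines S : \sum_(l in L) #|l :&: S| = #|S| * n.+1.
Proof.
rewrite (sum_mem_card _ id) -sum_nat_const.
apply: eq_bigr => x _; rewrite -(plane_card_pencil x).
by apply: eq_card => l; rewrite !inE.
Qed.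

(** One factor of the square is expanded over the points of [S] on the line; [sum_pencil] then
    applies at each of them. *)
Lemma sum_card_lines_sq S :
  \sum_(l in L) #|l :&: S| ^ 2 = #|S| * (#|S| + n).
Proof.
have -> : \sum_(l in L) #|l :&: S| ^ 2 =
    \sum_(l in L) \sum_(x in S | x \in l) #|l :&: S|.
  apply: eq_bigr => l _; rewrite sum_nat_const -mulnn; congr (_ * _).
  by apply: eq_card => x; rewrite !inE andbC.
rewrite (exchange_big_dep (mem S)) /=; last by move=> l x _ /andP[].
rewrite -sum_nat_const; apply: eq_bigr => x xS.
have := sum_pencil S x; rewrite xS mul1n => <-; exact: eq_bigl.
Qed.

End Plane.

(** * Perfect matchings of six labels *)

Lemma pms_range m p : p \in nth [::] pms m -> [/\ p.1 < p.2, p.1 < 6 & p.2 < 6].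
Proof.
have /allP h : all (all (fun p => [&& p.1 < p.2, p.1 < 6 & p.2 < 6])) pms.
  by vm_compute.
have [m15|m15] := ltnP m (size pms); last by rewrite nth_default.
by move=> pm; apply/and3P; apply: (allP (h _ (mem_nth [::] m15)) p).
Qed.

Lemma pms_uniq m p q : p \in nth [::] pms m -> q \in nth [::] pms m -> p != q ->
  uniq [:: p.1; p.2; q.1; q.2].
Proof.
have /allP h : all (fun m => all (fun p => all (fun q => (p != q) ==>
    uniq [:: p.1; p.2; q.1; q.2]) m) m) pms by vm_compute.
have [m15|m15] := ltnP m (size pms); last by rewrite nth_default.
move=> pm qm; apply/implyP.
exact: (allP (allP (h _ (mem_nth [::] m15)) p pm) q qm).
Qed.

Lemma pms_third m p q i j : p \in nth [::] pms m -> q \in nth [::] pms m -> p != q ->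
  i < j -> j < 6 -> uniq [:: p.1; p.2; q.1; q.2; i; j] -> (i, j) \in nth [::] pms m.
Proof.
have /allP h : all (fun m => all (fun p => all (fun q => all (fun j => all (fun i =>
    (p != q) ==> (uniq [:: p.1; p.2; q.1; q.2; i; j] ==> ((i, j) \in m)))
    (iota 0 j)) (iota 0 6)) m) m) pms by vm_compute.
have [m15|m15] := ltnP m (size pms); last by rewrite nth_default.
move=> pm qm pq ij j6 u.
have jI : j \in iota 0 6 by rewrite mem_iota.
have iI : i \in iota 0 j by rewrite mem_iota.
have := allP (allP (allP (allP (h _ (mem_nth [::] m15)) p pm) q qm) j jI) i iI.
by rewrite pq u.
Qed.

Lemma pms_rest m p q r s : p \in nth [::] pms m -> q \in nth [::] pms m ->
  r \in nth [::] pms m -> s \in nth [::] pms m ->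
  p != q -> r != p -> r != q -> s != p -> s != q -> r = s.
Proof.
have /allP h : all (fun m => all (fun p => all (fun q => all (fun r => all (fun s =>
    [&& p != q, r != p, r != q, s != p & s != q] ==> (r == s)) m) m) m) m) pms.
  by vm_compute.
have [m15|m15] := ltnP m (size pms); last by rewrite nth_default.
move=> pm qm rm sm pq rp rq sp sq.
have := allP (allP (allP (allP (h _ (mem_nth [::] m15)) p pm) q qm) r rm) s sm.
by rewrite pq rp rq sp sq => /eqP.
Qed.

Lemma pms_two m : m < 15 -> exists p q,
  [/\ p \in nth [::] pms m, q \in nth [::] pms m & p != q].
Proof.
move=> m15; pose a i := nth (0, 0) (nth [::] pms m) i; exists (a 0), (a 1).
have /allP h : all (fun m => let a i := nth (0, 0) m i in
    [&& a 0 \in m, a 1 \in m & a 0 != a 1]) pms by vm_compute.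
by case/and3P: (h _ (mem_nth [::] (m15 : m < size pms))) => *; split.
Qed.

Lemma pms_through i j k l : i < j -> j < 6 -> k < l -> l < 6 -> uniq [:: i; j; k; l] ->
  exists2 m, m < 15 & ((i, j) \in nth [::] pms m) && ((k, l) \in nth [::] pms m).
Proof.
move=> ij j6 kl l6 u.
have h : all (fun j => all (fun l => all (fun i => all (fun k => uniq [:: i; j; k; l] ==>
    has (fun m => ((i, j) \in nth [::] pms m) && ((k, l) \in nth [::] pms m)) (iota 0 15))
    (iota 0 l)) (iota 0 j)) (iota 0 6)) (iota 0 6) by vm_compute.
have I a b : a < b -> a \in iota 0 b by rewrite mem_iota.
have := allP (allP (allP (allP h j (I _ _ j6)) l (I _ _ l6)) i (I _ _ ij)) k (I _ _ kl).
by rewrite u => /hasP[m]; rewrite mem_iota => ? ?; exists m.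
Qed.

Lemma pms_inj m m' p q : m < 15 -> m' < 15 -> p != q ->
  p \in nth [::] pms m -> q \in nth [::] pms m ->
  p \in nth [::] pms m' -> q \in nth [::] pms m' -> m = m'.
Proof.
move=> m15 m15' pq pm qm pm' qm'.
have h : all (fun m => all (fun m' => all (fun p => all (fun q =>
   [&& p != q, p \in nth [::] pms m' & q \in nth [::] pms m'] ==> (m == m'))
   (nth [::] pms m)) (nth [::] pms m)) (iota 0 15)) (iota 0 15) by vm_compute.
have I a : a < 15 -> a \in iota 0 15 by rewrite mem_iota.
have := allP (allP (allP (allP h m (I _ m15)) m' (I _ m15')) p pm) q qm.
by rewrite pq pm' qm' => /eqP.
Qed.

Lemma ltn_neq i j : i < j -> i != j.
Proof. by rewrite ltn_neqAle => /andP[]. Qed.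

(** * Cells, enumeration of blocks, and images of cells *)

Lemma disj_sym a b : disj a b -> disj b a.
Proof. by rewrite /disj has_sym. Qed.

Lemma disj_neq a b : a < 15 -> disj a b -> a != b.
Proof.
move=> a15; apply: contraTneq => <-; have [p [_ [pm _ _]]] := pms_two a15.
by rewrite /disj negbK; apply/hasP; exists p.
Qed.

Lemma nth_cells0 c : c < 36 -> exists a b,
  [/\ nth (0, 0) cells0 c = (a, b), a < b, a < 15, b < 15
    & [/\ disj a b, a \in ms0 & b \in ms0]].
Proof.
move=> c36; case e: (nth _ _ _) => [a b]; exists a, b.
have /allP h : all (fun c => [&& c.1 < c.2, c.1 < 15, c.2 < 15, disj c.1 c.2,
  c.1 \in ms0 & c.2 \in ms0]) cells0 by vm_compute.
have := h _ (mem_nth (0, 0) (c36 : c < size cells0)); rewrite e.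
by case/and5P=> /= -> -> -> -> /andP[-> ->].
Qed.

Lemma nth_cidx a b : cidx a b < 36 -> nth (0, 0) cells0 (cidx a b) = sort2 a b.
Proof. by move=> ab; rewrite nth_index // -index_mem. Qed.

Lemma cidx_lt36 a b : a \in ms0 -> b \in ms0 -> disj a b -> cidx a b < 36.
Proof.
move=> am bm ab.
have /allP h : all (fun a => all (fun b => disj a b ==> (cidx a b < 36)) ms0) ms0.
  by vm_compute.
by have := allP (h a am) b bm; rewrite ab.
Qed.

Lemma ms0P a : a \in ms0 = (a < 15) && ((0, 1) \notin nth [::] pms a).
Proof.
have [a15|a15] := ltnP a 15; last first.
  by apply/negP => /(allP (isT : all (fun a => a < 15) ms0)); rewrite ltnNge a15.
have /allP h : all (fun a => (a \in ms0) == ((0, 1) \notin nth [::] pms a)) (iota 0 15).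
  by vm_compute.
by apply/eqP/h; rewrite mem_iota.
Qed.

Lemma cidxC a b : cidx a b = cidx b a.
Proof. by rewrite /cidx (_ : sort2 a b = sort2 b a) // /sort2; case: ltngtP => // ->. Qed.

(** A fixed-point-free involution [f] is a perfect matching of [s]: the head is paired with its
    image, and [f] restricts to the rest. The bound on [size s] makes [n] rounds enough. *)
Lemma enum_blocks_ex (f : nat -> nat) n s : size s <= n.*2 -> uniq s ->
  (forall a, a \in s -> [/\ f a \in s, f (f a) = a, f a != a & disj a (f a)]) ->
  exists2 b, b \in enum_blocks n s &
    (forall a, a \in s -> cidx a (f a) \in b) /\
    (forall c, c \in b -> exists2 a, a \in s & c = cidx a (f a)).
Proof.
elim: n s => [|n IH] [|i s] //=; try by move=> _ _ _; exists [::]; rewrite ?inE; [|split].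
move=> sz /andP[is_ us] hf; have [fi ffi nfi di] := hf i (mem_head _ _).
have {}fi : f i \in s by move: fi; rewrite inE (negPf nfi).
have [||a|b bE [b1 b2]] := IH [seq k <- s | k != f i].
- rewrite -ltnS -(leq_add2r 1) addn1 size_filter -(count_predC (pred1 (f i)) s) in sz *.
  move: sz; rewrite count_uniq_mem // fi (eq_count (a2 := fun k => k != f i)) //.
  by rewrite doubleS; lia.
- exact: filter_uniq.
- rewrite !mem_filter => /andP[afi as_].
  have ais : a \in i :: s by rewrite inE as_ orbT.
  have [fa ffa nfa da] := hf a ais.
  have fai : f a != i by apply: contraNneq afi => <-; rewrite ffa.
  rewrite inE (negPf fai) /= in fa; rewrite fa andbT; split=> //.
  by apply: contraNneq is_ => e; rewrite -ffi -e ffa.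
exists (cidx i (f i) :: b).
  apply/flattenP.
  exists [seq cidx i (f i) :: b | b <- enum_blocks n [seq k <- s | k != f i]].
    by apply/mapP; exists (f i); rewrite ?mem_filter ?di.
  exact: map_f.
split=> [a|c]; rewrite inE.
  case/orP=> [/eqP->|as_]; first exact: mem_head.
  have [->|afi] := eqVneq a (f i); first by rewrite ffi cidxC mem_head.
  by rewrite inE b1 ?orbT // mem_filter afi.
case/orP=> [/eqP->|/b2[a]]; first by exists i; rewrite ?mem_head.
by rewrite mem_filter => /andP[_ as_] ->; exists a; rewrite // inE as_ orbT.
Qed.

(** The enumeration always pairs off the current head, so equal partners give the same list, not
    just the same set. *)
Lemma enum_blocks_inj n s b b' : b \in enum_blocks n s -> b' \in enum_blocks n s ->
  (forall i j k, i \in s -> j \in s -> k \in s -> disj i j -> disj i k ->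
     cidx i j \in b -> cidx i k \in b' -> j = k) ->
  b = b'.
Proof.
elim: n s b b' => [|n IH] [|i s] b b' /=; rewrite ?inE.
1-3: by move=> /eqP-> /eqP->.
move=> /flattenP[_ /mapP[j + ->] /mapP[b1 bE ->]].
move=> + /flattenP[_ /mapP[k + ->] /mapP[b2 bE' ->]].
rewrite !mem_filter => /andP[ij js] /andP[ik ks] inj.
have ejk : j = k.
  by apply: (inj i); rewrite ?mem_head // inE ?js ?ks orbT.
rewrite -{}ejk {k ik ks} in bE' inj *; congr cons; apply: (IH _ _ _ bE bE').
move=> a c d; rewrite !mem_filter => /andP[_ as_] /andP[_ cs] /andP[_ ds] ac ad cb db.
apply: (inj a c d _ _ _ ac ad); rewrite in_cons; apply/orP; right; assumption.
Qed.

Lemma blocks0E : blocks0 = enum_blocks 6 ms0.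
Proof. by vm_compute. Qed.

Lemma cells0_inj c d : c < 36 -> d < 36 -> nth (0, 0) cells0 c = nth (0, 0) cells0 d ->
  c = d.
Proof.
by move=> c36 d36 /eqP; rewrite nth_uniq // => /eqP.
Qed.

Lemma cidx_nth a b c : c < 36 -> nth (0, 0) cells0 c = (a, b) -> a < b -> cidx a b = c.
Proof.
move=> c36 e ab; rewrite /cidx /sort2 ab -e index_uniq //; by vm_compute.
Qed.

Lemma mimgP g t p : t < 15 -> mimg g (nth [::] pms t) < 15 -> p \in nth [::] pms t ->
  (nth 0 g p.1, nth 0 g p.2) \in nth [::] pms (mimg g (nth [::] pms t)) \/
  (nth 0 g p.2, nth 0 g p.1) \in nth [::] pms (mimg g (nth [::] pms t)).
Proof.
move=> t15 m15 pt.
have : has (fun m' => all (fun p => let i := nth 0 g p.1 in let j := nth 0 g p.2 in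
  ((i, j) \in m') || ((j, i) \in m')) (nth [::] pms t)) pms by rewrite has_find.
by move/(nth_find [::])/allP/(_ p pt)/orP.
Qed.

(** A value below 36 excludes every default: both entries of a genuine cell are below 15, so both
    matchings have images. *)
Lemma cmap_nth g c : c < 36 -> nth 36 (cmap g) c < 36 -> exists a b,
  [/\ nth (0, 0) cells0 c = (a, b), a < 15, b < 15,
      mimg g (nth [::] pms a) < 15 /\ mimg g (nth [::] pms b) < 15
    & nth 36 (cmap g) c = cidx (mimg g (nth [::] pms a)) (mimg g (nth [::] pms b))].
Proof.
move=> c36; have [a [b [e ab a15 b15 _]]] := nth_cells0 c36.
have E t : t < 15 -> nth 0 [seq mimg g m | m <- pms] t = mimg g (nth [::] pms t).
  by move=> t15; rewrite (nth_map [::]).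
rewrite /cmap (nth_map (0, 0)) // e -[(a, b).1]/a -[(a, b).2]/b !E // => lt.
exists a, b.
split=> //.
have /allP h : all (fun c => (c.1 < 15) && (c.2 < 15)) cells0 by vm_compute.
have := h _ (mem_nth (0, 0) (lt : _ < size cells0)); rewrite nth_cidx //.
by rewrite /sort2; case: ifP => _ /andP[].
Qed.

(** * Fifteen points meeting every line oddly *)

Section OddSet.

Variable Pi : projective_plane 10.
Local Notation pt := (plane_point Pi).
Local Notation L := (plane_lines Pi).
Variable S : {set pt}.
Hypothesis card_S : #|S| = 15.
Hypothesis odd_S : forall l, l \in L -> odd #|l :&: S|.
Hypothesis card_L : #|L| = 111.
Implicit Types (x y : pt) (l m : {set pt}).

Definition secant (k : nat) l : bool := (l \in L) && (#|l :&: S| == k).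

Lemma sum_pencil_excess x :
  \sum_(l in L | x \in l) (#|l :&: S|).-1 = 4 + (x \in S) * 10.
Proof.
have c11 : \sum_(l in L | x \in l) 1 = 11.
  by rewrite -(plane_card_pencil x) -sum1_card; apply: eq_bigl => l; rewrite inE.
apply/eqP; rewrite -(eqn_add2r 11) -[X in _ + X]c11 -big_split /=.
rewrite (eq_bigr (fun l => #|l :&: S|)) => [|l /andP[lL _]].
  by rewrite sum_pencil card_S; case: (x \in S).
by rewrite addn1 prednK // odd_gt0 // odd_S.
Qed.

(** A point of [l] off [S] leaves [l] an excess of at most 4. If [l] lay inside [S], every line
    through a point of [S] off [l] would meet [S] at least twice, hence three times by parity:
    excess at least 22, but only 14 is available. *)
Lemma secant_le5 l : l \in L -> #|l :&: S| <= 5.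
Proof.
move=> lL; have [sub|/subsetPn[x xl xS]] := boolP (l \subset S); last first.
  have := sum_pencil_excess x; rewrite (negPf xS) (bigD1 l) ?lL //= => h.
  by move: h; case: #|l :&: S| => //=; lia.
have /subsetPn[q qS ql] : ~~ (S \subset l).
  by apply/negP => /subset_leq_card; rewrite card_S (plane_card_line lL).
have : \sum_(m in L | q \in m) 2 <= \sum_(m in L | q \in m) (#|m :&: S|).-1.
  apply: leq_sum => m /andP[mL qm]; have [x xm xl] := meet_ex mL lL.
  suff : 1 < #|m :&: S| by have := odd_S mL; case: #|_| => [|[|[|]]].
  have qx : q != x by apply: contraNneq ql => ->.
  have := cards2 q x; rewrite qx => c2.
  apply: (leq_trans (n := #|[set q; x]|)); first by rewrite c2.
  apply/subset_leq_card/subsetP => y; rewrite !inE => /orP[]/eqP->.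
    by rewrite qm.
  by rewrite xm (subsetP sub).
rewrite sum_pencil_excess qS sum_nat_const.
rewrite (_ : #|_| = 11) // -(plane_card_pencil q); apply: eq_card => m.
by rewrite !inE.
Qed.

Lemma secant_cases l : l \in L -> [|| secant 1 l, secant 3 l | secant 5 l].
Proof.
move=> lL; rewrite /secant lL /=; have := odd_S lL; have := secant_le5 lL.
by move: #|_| => [|[|[|[|[|[|]]]]]].
Qed.

Definition heavy : {set {set pt}} := [set l | secant 5 l].

Lemma card_heavy : #|heavy| = 6.
Proof.
(* (k - 1) * (k - 3) is 8 for k = 5 and 0 for k = 1, 3 *)
have E : \sum_(l in L) (#|l :&: S| ^ 2 + 3) =
         \sum_(l in L) (#|l :&: S| * 4 + secant 5 l * 8).
  apply: eq_bigr => l lL; have := secant_cases lL; rewrite /secant lL /=.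
  by case/or3P => /eqP->.
move: E; rewrite !big_split /= -!big_distrl /= sum_card_lines_sq sum_card_lines.
rewrite sum_nat_const card_S card_L.
have -> : \sum_(l in L) secant 5 l = #|heavy|.
  rewrite -sum1_card big_mkcond [RHS]big_mkcond; apply: eq_bigr => l _.
  by rewrite inE /secant; case: (l \in L) => //=; case: (_ == _).
by move: #|heavy| => k; lia.
Qed.

Lemma heavyP l : l \in heavy -> l \in L /\ #|l :&: S| = 5.
Proof. by rewrite inE => /andP[? /eqP]. Qed.

(** With h(y) heavy lines through y, the sum of h over [S] is 30 and that of h^2 is at most 60, so
    the sum of (h - 2)^2 over the 15 points is at most 0. *)
Lemma card_heavy_pencil x : x \in S -> #|[set l in heavy | x \in l]| = 2.
Proof.
pose h y := #|[set l in heavy | y \in l]|.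
have sum1 : \sum_(y in S) h y = 30.
  rewrite /h -(@sum_mem_card _ _ _ (mem heavy) id).
  rewrite (eq_bigr (fun _ => 5)) => [|l /heavyP[] //].
  by rewrite sum_nat_const card_heavy.
have sum2 : \sum_(y in S) h y ^ 2 <= 60.
  have -> : \sum_(y in S) h y ^ 2 =
      \sum_(l in heavy) \sum_(m in heavy) #|(l :&: m) :&: S|.
    rewrite pair_big_dep /= (@sum_mem_card _ _ _ _ (fun p => p.1 :&: p.2)).
    apply: eq_bigr => y _; rewrite /h -mulnn -cardsX; apply: eq_card => -[l m].
    by rewrite !inE /=; do !case: (_ \in _); rewrite ?andbF ?andbT.
  (* Each heavy line contributes 5 with itself and at most 1 with each of the five others. *)
  have -> : 60 = \sum_(l in heavy) 10 by rewrite sum_nat_const card_heavy.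
  apply: leq_sum => l lh; have [lL l5] := heavyP lh.
  rewrite (bigD1 l) //= setIid l5.
  have c5 : \sum_(m in heavy | m != l) 1 = 5.
    have := cardD1 l (mem heavy); rewrite card_heavy lh sum1_card => -[e].
    transitivity #|[predD1 heavy & l]|; last exact: esym e.
    by apply: eq_card => m; rewrite -!topredE /= andbC.
  apply: (leq_trans (n := 5 + \sum_(m in heavy | m != l) 1)); last by rewrite c5.
  rewrite leq_add2l; apply: leq_sum => m /andP[mh ml]; have [mL _] := heavyP mh.
  rewrite leqNgt; apply/negP => /card_gt1P[y [z [+ + /eqP[]]]].
  rewrite !inE => /andP[/andP[yl ym] _] /andP[/andP[zl zm] _].
  exact: meet_inj mL lL ml ym yl zm zl.
have amgm y : y \in S -> h y * 4 <= h y ^ 2 + 4 ?= iff (h y == 2).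
  by move=> _; apply/leqifP; case: eqP => [->//|]; nia.
have [le eqE] := leqif_sum amgm; move: eqE.
have -> : \sum_(y in S) h y * 4 == \sum_(y in S) (h y ^ 2 + 4).
  rewrite eqn_leq le big_split /= -big_distrl /= sum1 sum_nat_const card_S.
  by move: sum2; lia.
by move=> /esym/forall_inP h2 xS; apply/eqP/h2.
Qed.

Lemma excess_out (A : {set {set pt}}) x : x \notin S ->
  (forall l, l \in A -> l \in L /\ x \in l) -> \sum_(l in A) (#|l :&: S|).-1 <= 4.
Proof.
move=> xS hA; have := sum_pencil_excess x; rewrite (negPf xS) => e.
rewrite -[4]/(4 + 0 * 10); apply: (leq_trans _ (eq_leq e)).
rewrite [X in _ <= X](bigID (mem A)) /= -[X in X <= _]addn0 leq_add //.
rewrite [X in _ <= X](eq_bigl (fun l => l \in A)) // => l; have := hA l.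
by case: (l \in A) => [/(_ isT)[-> ->]|]; rewrite ?andbF.
Qed.

Lemma excess_out2 x l m : x \notin S -> l \in L -> m \in L -> l != m ->
  x \in l -> x \in m -> #|l :&: S|.-1 + #|m :&: S|.-1 <= 4.
Proof.
move=> xS lL mL lm xl xm; have := @excess_out [set l; m] x xS.
rewrite big_setU1 ?inE ?lm //= big_set1; apply=> k.
by rewrite !inE => /orP[]/eqP->.
Qed.

Lemma excess_out3 x l m k : x \notin S -> l \in L -> m \in L -> k \in L ->
  l != m -> l != k -> m != k -> x \in l -> x \in m -> x \in k ->
  #|l :&: S|.-1 + #|m :&: S|.-1 + #|k :&: S|.-1 <= 4.
Proof.
move=> xS lL mL kL lm lk mk xl xm xk; have := @excess_out [set l; m; k] x xS.
rewrite setUC big_setU1 ?inE ?[k == _]eq_sym ?negb_or ?lk ?mk //=.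
rewrite big_setU1 ?inE ?lm //= big_set1 addnC; apply=> j.
by rewrite !inE => /orP[|/orP[]]/eqP->.
Qed.

(** The 3-secant uses 2 of the excess 4; the remaining 2 is too small for a heavy line. *)
Lemma secant3_out x l : x \notin S -> secant 3 l -> x \in l ->
  exists m, [/\ m != l, x \in m & secant 3 m].
Proof.
move=> xS /andP[lL /eqP l3] xl.
have := sum_pencil_excess x; rewrite (negPf xS) (bigD1 l) ?lL //= l3.
move=> e; have : \sum_(m | (m \in L) && (x \in m) && (m != l)) #|m :&: S|.-1 != 0.
  by apply/eqP => e0; rewrite e0 in e.
rewrite sum_nat_eq0 negb_forall => /existsP[m].
rewrite negb_imply => /andP[/andP[/andP[mL xm] ml] m1]; exists m; split=> //.
have := excess_out2 xS lL mL _ xl xm; rewrite eq_sym ml l3 => /(_ isT) le4.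
by case/or3P: (secant_cases mL) => // /andP[_ /eqP c];
   rewrite c in m1 le4.
Qed.

(** * Labelled heavy lines and the 3-secants of matchings *)

Definition act (H : seq {set pt}) (k : seq nat) : seq {set pt} :=
  [seq nth set0 H i | i <- k].

Definition valid (H : seq {set pt}) : Prop :=
  [/\ size H = 6, uniq H & {subset H <= heavy}].

Definition pnt (H : seq {set pt}) (p : nat * nat) : {set pt} :=
  nth set0 H p.1 :&: nth set0 H p.2.

(** The 3-secant of a matching; the default [set0] does not occur for indices below 15, by
    [tlineP]. *)
Definition tline (H : seq {set pt}) (m : nat) : {set pt} :=
  odflt set0 [pick l in L | all (fun p => pnt H p \subset l) (nth [::] pms m)].

Section OneLabelling.

Variable H : seq {set pt}.
Hypothesis vH : valid H.
Local Notation h i := (nth set0 H i).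

Lemma heavy_nth i : i < 6 -> h i \in heavy.
Proof. by case: vH => sz _ sub i6; apply/sub/mem_nth; rewrite sz. Qed.

Lemma line_nth i : i < 6 -> h i \in L.
Proof. by move/heavy_nth/heavyP => []. Qed.

Lemma nth_inj i j : i < 6 -> j < 6 -> h i = h j -> i = j.
Proof.
case: vH => sz u _ i6 j6 /eqP; rewrite nth_uniq ?sz // => /eqP //.
Qed.

Lemma heavy_ex l : l \in heavy -> exists2 i, i < 6 & l = h i.
Proof.
case: vH => sz u sub lh.
have : l \in H.
  have [] := uniq_min_size (s2 := enum heavy) u.
  - by move=> k; rewrite mem_enum; apply: sub.
  - by rewrite -cardE (card_heavy) sz.
  - by move=> _ /(_ l); rewrite mem_enum lh.
by move/(nthP set0) => [i]; rewrite sz => i6 <-; exists i.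
Qed.

(** Two heavy lines meeting off [S] would have total excess 8 there. *)
Lemma pnt_meet i j : i < 6 -> j < 6 -> i != j ->
  exists2 x, x \in S & pnt H (i, j) = [set x].
Proof.
move=> i6 j6 ij; have [x xi xj] := meet_ex (line_nth i6) (line_nth j6).
have hij : h i != h j by apply: contraNneq ij => /(nth_inj i6 j6)->.
exists x; last first.
  apply/setP=> y; rewrite !inE; apply/andP/eqP => [[yi yj]|->//].
  exact: meet_inj (line_nth i6) (line_nth j6) hij yi yj xi xj.
apply: contraT => xS.
have := excess_out2 xS (line_nth i6) (line_nth j6) hij xi xj.
by rewrite (heavyP (heavy_nth i6)).2 (heavyP (heavy_nth j6)).2.
Qed.

Lemma pnt_S i j x : i < 6 -> j < 6 -> i != j -> x \in pnt H (i, j) -> x \in S.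
Proof. by move=> i6 j6 /(pnt_meet i6 j6)[y yS ->] /set1P->. Qed.

Lemma pnt_nth i j k x : i < 6 -> j < 6 -> k < 6 -> i != j -> x \in pnt H (i, j) ->
  x \in h k -> (k == i) || (k == j).
Proof.
move=> i6 j6 k6 ij xij xk; have xS := pnt_S i6 j6 ij xij.
have c2 := card_heavy_pencil xS.
move: xij; rewrite inE /= => /andP[xi xj].
apply: contraT; rewrite negb_or => /andP[ki kj].
have : #|[set h i; h j; h k]| <= 2.
  apply: (leq_trans (n := #|[set l in heavy | x \in l]|)); last by rewrite c2.
  apply/subset_leq_card/subsetP => l ol; apply/setIdP.
  by case/setUP: ol => [/setUP[]|] /set1P->; split; rewrite ?xi ?xj ?xk // heavy_nth.
have D a b : a < 6 -> b < 6 -> a != b -> (h a == h b) = false.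
  by move=> a6 b6 ab; apply: contraNF ab => /eqP/(nth_inj a6 b6)->.
by rewrite setUC cardsU1 !inE cards2 !D // eq_sym.
Qed.

Lemma pnt_ex x : x \in S -> exists i j, [/\ i < j, j < 6 & x \in pnt H (i, j)].
Proof.
move=> xS; have c2 := card_heavy_pencil xS.
have /card_gt1P[l [m [+ + lm]]] : 1 < #|[set l in heavy | x \in l]| by rewrite c2.
move=> /setIdP[/heavy_ex[i i6 el] xi] /setIdP[/heavy_ex[j j6 em] xj].
rewrite el in xi lm; rewrite em in xj lm => {l m el em}.
have ij : i != j by apply: contraNneq lm => ->.
wlog ltij : i j i6 j6 xi xj ij {lm} / i < j => [W|]; last first.
  by exists i, j; split=> //; rewrite inE xi.
case: (ltngtP i j) => lt; [exact: W lt | | by rewrite lt eqxx in ij].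
by apply: (W j i) => //; rewrite eq_sym.
Qed.

(* A line through two of the points [pnt H p] of a perfect matching contains  *)
(* the third one: it cannot be heavy, so it is a 3-secant, and its third      *)
(* point lies on neither of the heavy lines through the first two.            *)
Lemma tline_two_points t p q l : p \in nth [::] pms t -> q \in nth [::] pms t -> p != q ->
  l \in L -> pnt H p \subset l -> pnt H q \subset l ->
  [/\ #|l :&: S| = 3,
      forall i j x, i < j -> j < 6 -> x \in pnt H (i, j) -> x \in l ->
        (i, j) \in nth [::] pms t
    & forall r, r \in nth [::] pms t -> pnt H r \subset l].
Proof.
move=> pm qm pq lL pl ql.
have u := pms_uniq pm qm pq.
have [p12 p1 p2] := pms_range pm; have [q12 q1 q2] := pms_range qm.
have [x xS ex] := pnt_meet p1 p2 (ltn_neq p12).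
have [y yS ey] := pnt_meet q1 q2 (ltn_neq q12).
have xp : x \in pnt H (p.1, p.2) by rewrite ex set11.
have yq : y \in pnt H (q.1, q.2) by rewrite ey set11.
have xl : x \in l by apply: (subsetP pl); rewrite -surjective_pairing in xp.
have yl : y \in l by apply: (subsetP ql); rewrite -surjective_pairing in yq.
have pnt_disj k : k < 6 -> x \in h k -> y \in h k -> False.
  move=> k6 /(pnt_nth p1 p2 k6 (ltn_neq p12) xp) /orP e1.
  move=> /(pnt_nth q1 q2 k6 (ltn_neq q12) yq) /orP e2.
  by move: u; case: e1 => /eqP <-; case: e2 => /eqP <-; rewrite /= !inE eqxx ?orbT ?andbF.
have xy : x != y.
  apply/eqP => e; move: (yq) => /setIP[y1 _]; apply: (pnt_disj _ q1) => //.
  by rewrite e.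
have l_heavy k : k < 6 -> l != h k.
  by move=> k6; apply/eqP => e; apply: (pnt_disj k); rewrite -?e.
have l3 : #|l :&: S| = 3.
  case/or3P: (secant_cases lL) => [|/andP[_ /eqP] //|] l15.
    have : 1 < #|l :&: S|; last by case/andP: l15 => _ /eqP->.
    by apply/card_gt1P; exists x, y; rewrite !inE xl yl xS yS.
  have /heavy_ex[k k6 e] : l \in heavy by rewrite inE.
  by have := l_heavy k k6; rewrite e eqxx.
have other i j z : i < j -> j < 6 -> z \in pnt H (i, j) -> z \in l ->
    [\/ (i, j) = p, (i, j) = q | uniq [:: p.1; p.2; q.1; q.2; i; j]].
  move=> ij j6 zij zl; have i6 := ltn_trans ij j6.
  (* If {i,j} shares a label with a point already on [l], the heavy line of that label meets [l]
     only once, so the two points coincide. *)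
  have share a b w k : a < b -> b < 6 -> w \in pnt H (a, b) -> w \in l ->
      (k == i) || (k == j) -> (k == a) || (k == b) -> (i, j) = (a, b).
    move=> ab b6 wab wl ki ka; have a6 := ltn_trans ab b6.
    have k6 : k < 6 by case/orP: ki => /eqP->.
    have zk : z \in h k by case/setIP: zij => ? ?; case/orP: ki => /eqP->.
    have wk : w \in h k by case/setIP: wab => ? ?; case/orP: ka => /eqP->.
    have ewz := meet_inj lL (line_nth k6) (l_heavy k k6) zl zk wl wk.
    rewrite ewz in zij; move/setIP: (zij) => [wi wj].
    have A := pnt_nth a6 b6 i6 (ltn_neq ab) wab wi.
    have B := pnt_nth a6 b6 j6 (ltn_neq ab) wab wj.
    by have [-> ->] : i = a /\ j = b by clear -A B ij ab; lia.
  rewrite [p]surjective_pairing [q]surjective_pairing.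
  have [k|p1n] := boolP ((p.1 == i) || (p.1 == j)).
    by apply: Or31; apply: (share _ _ x p.1); rewrite ?eqxx.
  have [k|p2n] := boolP ((p.2 == i) || (p.2 == j)).
    by apply: Or31; apply: (share _ _ x p.2); rewrite ?eqxx ?orbT.
  have [k|q1n] := boolP ((q.1 == i) || (q.1 == j)).
    by apply: Or32; apply: (share _ _ y q.1); rewrite ?eqxx.
  have [k|q2n] := boolP ((q.2 == i) || (q.2 == j)).
    by apply: Or32; apply: (share _ _ y q.2); rewrite ?eqxx ?orbT.
  apply: Or33; rewrite -[[:: _; _; _; _; i; j]]/([:: p.1; p.2; q.1; q.2] ++ [:: i; j]).
  rewrite cat_uniq u /= !inE (ltn_neq ij) /= orbF andbT !negb_or.
  move: p1n p2n q1n q2n; rewrite !negb_or !(eq_sym i) !(eq_sym j).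
  by do 4![case/andP=> -> ->].
have second i j z : i < j -> j < 6 -> z \in pnt H (i, j) -> z \in l ->
    (i, j) \in nth [::] pms t.
  move=> ij j6 zij zl; have [->|->|] // := other i j z ij j6 zij zl.
  exact: pms_third.
split=> // r rt.
have [->//|rp] := eqVneq r p; have [->//|rq] := eqVneq r q.
have [z zlS /andP[zx zy]] : exists2 z, z \in l :&: S & (z != x) && (z != y).
  have c : #|l :&: S :\ x :\ y| = 1.
    have := cardsD1 x (l :&: S); rewrite l3 [x \in _]inE xl xS => -[].
    by rewrite (cardsD1 y) !inE yl yS eq_sym xy => -[e]; apply: esym.
  have /card_gt0P[z] : 0 < #|l :&: S :\ x :\ y| by rewrite c.
  by rewrite in_setD1 => /andP[zy /setD1P[zx zlS]]; exists z; rewrite ?zx.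
case/setIP: zlS => zl /pnt_ex[i [j [ij j6 zij]]].
have ijt := second i j z ij j6 zij zl.
have ijp : (i, j) != p.
  by apply: contraNneq zx => e; move: zij; rewrite e [p]surjective_pairing ex inE.
have ijq : (i, j) != q.
  by apply: contraNneq zy => e; move: zij; rewrite e [q]surjective_pairing ey inE.
rewrite (pms_rest pm qm rt ijt pq rp rq ijp ijq).
have [z' _ ez] := pnt_meet (ltn_trans ij j6) j6 (ltn_neq ij).
by move: zij; rewrite ez => /set1P <-; rewrite sub1set.
Qed.

Lemma tlineP t : t < 15 -> exists p q,
  [/\ p \in nth [::] pms t, q \in nth [::] pms t, p != q, tline H t \in L
    & pnt H p \subset tline H t /\ pnt H q \subset tline H t].
Proof.
move=> t15; have [p [q [pm qm pq]]] := pms_two t15; exists p, q.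
have [p12 p1 p2] := pms_range pm; have [q12 q1 q2] := pms_range qm.
have [x xS ex] := pnt_meet p1 p2 (ltn_neq p12).
have [y yS ey] := pnt_meet q1 q2 (ltn_neq q12).
rewrite -!surjective_pairing in ex ey.
have [l [lL xl yl]] := join_ex x y.
have [||l3 _ hl] := tline_two_points pm qm pq lL; rewrite ?ex ?ey ?sub1set //.
rewrite /tline; case: pickP => [k /andP[kL /allP hk]|/(_ l)/=]; last first.
  by rewrite lL; case/negP; apply/allP.
by split=> //; split; rewrite -sub1set; [rewrite -ex|rewrite -ey]; apply: hk.
Qed.

Lemma tline_line t : t < 15 -> tline H t \in L.
Proof. by case/tlineP=> p [q []]. Qed.

Lemma tline_card t : t < 15 -> #|tline H t :&: S| = 3.
Proof.
case/tlineP=> p [q [pm qm pq lL [pl ql]]].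
by have [] := tline_two_points pm qm pq lL pl ql.
Qed.

Lemma tline_pnt t r : t < 15 -> r \in nth [::] pms t -> pnt H r \subset tline H t.
Proof.
case/tlineP=> p [q [pm qm pq lL [pl ql]]].
by have [_ _] := tline_two_points pm qm pq lL pl ql; apply.
Qed.

Lemma tline_mem t i j x : t < 15 -> i < j -> j < 6 -> x \in pnt H (i, j) ->
  x \in tline H t -> (i, j) \in nth [::] pms t.
Proof.
case/tlineP=> p [q [pm qm pq lL [pl ql]]].
by have [_ + _] := tline_two_points pm qm pq lL pl ql; apply.
Qed.

Lemma pnt_neq i j k b x y : i < 6 -> j < 6 -> k < 6 -> b < 6 -> i != j -> k != b ->
  ~~ perm_eq [:: i; j] [:: k; b] -> x \in pnt H (i, j) -> y \in pnt H (k, b) -> x != y.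
Proof.
move=> i6 j6 k6 b6 ij kb ne xij /setIP[/= yk yb]; apply: contra ne => /eqP e.
rewrite -e in yk yb.
have := pnt_nth i6 j6 k6 ij xij yk; have := pnt_nth i6 j6 b6 ij xij yb.
case/orP=> /eqP eb; case/orP=> /eqP ek; rewrite eb ek ?eqxx in kb *; rewrite //.
exact: (permEl (perm_catC [:: i] [:: j])).
Qed.

Lemma pms_pnt_neq t p q x y : p \in nth [::] pms t -> q \in nth [::] pms t -> p != q ->
  x \in pnt H p -> y \in pnt H q -> x != y.
Proof.
move=> pm qm pq; have [p12 p1 p2] := pms_range pm; have [q12 q1 q2] := pms_range qm.
rewrite [p]surjective_pairing [q]surjective_pairing.
apply: pnt_neq (ltn_neq p12) (ltn_neq q12) _ => //.
apply/negP => /perm_mem /(_ p.1); have := pms_uniq pm qm pq.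
by rewrite /= !inE eqxx /= !negb_or => /andP[/and3P[_ /negPf-> /negPf->]].
Qed.

Lemma tline_inj t t' : t < 15 -> t' < 15 -> tline H t = tline H t' -> t = t'.
Proof.
move=> t15 t15' e; case: (tlineP t15) => p [q [pm qm pq lL [pl ql]]].
have M r : r \in nth [::] pms t -> pnt H r \subset tline H t -> r \in nth [::] pms t'.
  move=> rt; have [r12 r1 r2] := pms_range rt.
  have [x xS ex] := pnt_meet r1 r2 (ltn_neq r12).
  have xr : x \in pnt H (r.1, r.2) by rewrite ex set11.
  rewrite {1 2}[r]surjective_pairing => /subsetP/(_ x xr); rewrite e.
  exact: tline_mem.
by apply: (pms_inj t15 t15' pq) => //; apply: M.
Qed.

(** Two points of [S] on [l] have no label in common, otherwise [l] would be heavy; so a matching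
    passes through both pairs. *)
Lemma secant3_tline l : secant 3 l -> exists2 t, t < 15 & l = tline H t.
Proof.
case/andP=> lL /eqP l3.
have /card_gt1P[x [y [/setIP[xl xS] /setIP[yl yS] xy]]] : 1 < #|l :&: S| by rewrite l3.
have [i [j [ij j6 xij]]] := pnt_ex xS; have [k [m [km m6 ykm]]] := pnt_ex yS.
have i6 := ltn_trans ij j6; have k6 := ltn_trans km m6.
have share a : a < 6 -> x \in h a -> y \in h a -> False.
  move=> a6 xa ya; have e := join_inj xy lL (line_nth a6) xl yl xa ya.
  by have [_] := heavyP (heavy_nth a6); rewrite -e l3.
have u : uniq [:: i; j; k; m].
  move/setIP: (xij) => [/= xi xj]; move/setIP: (ykm) => [/= yk ym].
  have N a b : a < 6 -> x \in h a -> y \in h b -> a != b.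
    by move=> a6 xa yb; apply/eqP => e; apply: (share a) => //; rewrite e.
  rewrite /= !inE !negb_or (ltn_neq ij) (ltn_neq km) !N //.
have [t t15 /andP[t1 t2]] := pms_through ij j6 km m6 u.
exists t => //; apply: (join_inj xy) => //; first exact: tline_line.
  by apply: subsetP xij; apply: tline_pnt.
by apply: subsetP ykm; apply: tline_pnt.
Qed.

End OneLabelling.

(** * Hexagon points and the blocks realized by lines *)

Definition hexpt (H : seq {set pt}) (c : nat) : {set pt} :=
  tline H (nth (0, 0) cells0 c).1 :&: tline H (nth (0, 0) cells0 c).2.

Definition real (H : seq {set pt}) (b : seq nat) : Prop := exists l,
  [/\ l \in L, pnt H (0, 1) \subset l & forall c, c \in b -> hexpt H c \subset l].

Section Hexagons.

Variable H : seq {set pt}.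
Hypothesis vH : valid H.

Lemma hexpt_cidx a b : cidx a b < 36 -> hexpt H (cidx a b) = tline H a :&: tline H b.
Proof.
by move=> ab; rewrite /hexpt nth_cidx // /sort2; case: ifP => _ //=; rewrite setIC.
Qed.

(** A common point in [S] would be a common pair of the matchings. Off [S], two 3-secants exhaust
    the excess 4. *)
Lemma tline_meet s t : s < 15 -> t < 15 -> disj s t -> exists x,
  [/\ x \notin S, tline H s :&: tline H t = [set x]
    & forall u, u < 15 -> x \in tline H u -> (u == s) || (u == t)].
Proof.
move=> s15 t15 st.
have D u v : u < 15 -> v < 15 -> u != v -> tline H u != tline H v.
  by move=> u15 v15 uv; apply: contraNneq uv => /(tline_inj vH u15 v15)->.
have st' := disj_neq s15 st.
have sL := tline_line vH s15; have tL := tline_line vH t15.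
have [x xs xt] := meet_ex sL tL.
have xS : x \notin S.
  apply/negP => /(pnt_ex vH)[i [j [ij j6 xij]]]; move: st; rewrite /disj.
  by case/hasP; exists (i, j); apply: (tline_mem vH _ ij j6 xij).
exists x; split=> //.
  apply/setP=> y; rewrite !inE; apply/andP/eqP => [[ys yt]|->//].
  exact: meet_inj sL tL (D _ _ s15 t15 st') ys yt xs xt.
move=> u u15 xu; apply: contraT; rewrite negb_or => /andP[us ut].
have := excess_out3 xS sL tL (tline_line vH u15) (D _ _ s15 t15 st') _ _ xs xt xu.
by rewrite !(tline_card vH) //; apply; apply: D; rewrite // eq_sym.
Qed.

Lemma out_single s t l x : s < 15 -> t < 15 -> disj s t ->
  x \in tline H s :&: tline H t ->
  l \in L -> x \in l -> l != tline H s -> l != tline H t -> #|l :&: S| = 1.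
Proof.
move=> s15 t15 st xst lL xl ls lt; have [y [yS e _]] := tline_meet s15 t15 st.
have xS : x \notin S by move: xst; rewrite e => /set1P->.
case/setIP: xst => xs xt.
have nst : tline H s != tline H t.
  by apply: contraNneq (disj_neq s15 st) => /(tline_inj vH s15 t15)->.
have := excess_out3 xS lL (tline_line vH s15) (tline_line vH t15) ls lt nst xl xs xt.
rewrite !(tline_card vH) //; have := odd_S lL; case: #|_| => [|[|k]] //=.
by rewrite addn2 addn2.
Qed.

(** The second 3-secant comes from [secant3_out]; a pair common to both matchings would give the two
    lines another common point, in [S]. *)
Lemma tline_partner s x : s < 15 -> x \in tline H s -> x \notin S ->
  exists t, [/\ t < 15, t != s, disj s t & x \in tline H t].
Proof.
move=> s15 xs xS; have sL := tline_line vH s15.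
have s3 : secant 3 (tline H s) by rewrite /secant sL (tline_card vH).
have [l [ls xl l3]] := secant3_out xS s3 xs.
have [t t15 e] := secant3_tline vH l3; rewrite {l}e in ls xl l3.
exists t; split=> //; first by apply: contraNneq ls => ->.
apply/negP => /hasP[p pt ps]; have [p12 p1 p2] := pms_range pt.
have [y yS ey] := pnt_meet vH p1 p2 (ltn_neq p12).
rewrite -surjective_pairing in ey.
have yl u : u < 15 -> p \in nth [::] pms u -> y \in tline H u.
  by move=> u15 /(tline_pnt vH u15); rewrite ey sub1set.
have e := meet_inj (tline_line vH t15) sL ls (yl _ t15 pt) (yl _ s15 ps) xl xs.
by rewrite e (negPf xS) in yS.
Qed.

Lemma tline_meet_uniq l i j k : l \in L -> l != tline H i ->
  i < 15 -> j < 15 -> k < 15 -> disj i j -> disj i k ->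
  tline H i :&: tline H j \subset l -> tline H i :&: tline H k \subset l -> j = k.
Proof.
move=> lL li i15 j15 k15 ij ik.
have [x [_ ex _]] := tline_meet i15 j15 ij; have [y [_ ey hy]] := tline_meet i15 k15 ik.
have /setIP[xi xj] : x \in tline H i :&: tline H j by rewrite ex set11.
have /setIP[yi yk] : y \in tline H i :&: tline H k by rewrite ey set11.
rewrite ex ey !sub1set => xl yl.
have e := meet_inj lL (tline_line vH i15) li xl xi yl yi; rewrite e in xj.
case/orP: (hy j j15 xj) => /eqP // e'.
by have := disj_neq i15 ij; rewrite e' eqxx.
Qed.

Lemma pnt01_out a x : a \in ms0 -> x \in pnt H (0, 1) -> x \notin tline H a.
Proof.
rewrite ms0P => /andP[a15 a01] x01; apply: contra a01.
exact: (tline_mem vH a15 _ _ x01).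
Qed.

Lemma hexpt_ex c : c < 36 -> exists2 x, x \notin S & hexpt H c = [set x].
Proof.
case/nth_cells0=> a [b [e _ a15 b15 [ab _ _]]].
by rewrite /hexpt e; have [x [xS ex _]] := tline_meet a15 b15 ab; exists x.
Qed.

Lemma hexpt_inj c d x : c < 36 -> d < 36 -> x \in hexpt H c -> x \in hexpt H d -> c = d.
Proof.
move=> c36 d36; have [a [b [e ltab a15 b15 [ab _ _]]]] := nth_cells0 c36.
have [a' [b' [e' ltab' a15' b15' _]]] := nth_cells0 d36.
rewrite /hexpt e e'; have [y [_ ey hy]] := tline_meet a15 b15 ab.
rewrite /= ey => /set1P -> /setIP[/(hy _ a15') A /(hy _ b15') B].
apply: cells0_inj => //; rewrite e e'.
by have [-> ->] : a = a' /\ b = b' by clear -A B ltab ltab'; lia.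
Qed.

(** The two 3-secants through the hexagon point miss the vertex {0,1}, so [l] is neither of them and
    no excess is left for it. *)
Lemma block_line_single l c : l \in L -> pnt H (0, 1) \subset l -> c < 36 ->
  hexpt H c \subset l -> #|l :&: S| = 1.
Proof.
move=> lL l01 c36; have [a [b [e _ a15 b15 [ab am bm]]]] := nth_cells0 c36.
have [q _ eq] := pnt_meet vH (isT : 0 < 6) (isT : 1 < 6) isT.
have q01 : q \in pnt H (0, 1) by rewrite eq set11.
have ql := subsetP l01 q q01.
have [x [_ ex _]] := tline_meet a15 b15 ab.
rewrite /hexpt e /= ex sub1set => xl.
apply: (out_single a15 b15 ab _ lL xl); first by rewrite ex set11.
  by apply/eqP => e'; have := pnt01_out am q01; rewrite -e' ql.
by apply/eqP => e'; have := pnt01_out bm q01; rewrite -e' ql.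
Qed.

Lemma block_line_tline l c t : l \in L -> pnt H (0, 1) \subset l -> c < 36 ->
  hexpt H c \subset l -> t < 15 -> l != tline H t.
Proof.
move=> lL l01 c36 cl t15; apply/eqP => e; have := block_line_single lL l01 c36 cl.
by rewrite e (tline_card vH).
Qed.

(** Join the vertex {0,1} to the hexagon point. This line meets each of the twelve 3-secants off
    [S], where exactly one other 3-secant passes; the resulting involution on [ms0] is a block. *)
Lemma real_cover c : c < 36 -> exists b, [/\ b \in blocks0, c \in b & real H b].
Proof.
move=> c36; have [a [b [e ltab a15 b15 [ab am bm]]]] := nth_cells0 c36.
have [q qS eq] := pnt_meet vH (isT : 0 < 6) (isT : 1 < 6) isT.
have q01 : q \in pnt H (0, 1) by rewrite eq set11.
have [x [xS ex _]] := tline_meet a15 b15 ab.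
have [l [lL ql xl]] := join_ex q x.
have l01 : pnt H (0, 1) \subset l by rewrite eq sub1set.
have cl : hexpt H c \subset l by rewrite /hexpt e /= ex sub1set.
have l1 := block_line_single lL l01 c36 cl.
have lt t : t < 15 -> l != tline H t by apply: block_line_tline lL l01 c36 cl.
(* [P m t]: the point where [l] meets the 3-secant of [m] is on that of [t] *)
pose P (m t : nat) := disj m t && (tline H m :&: tline H t \subset l).
have P_sym (m t : nat) : P m t -> P t m.
  by case/andP=> mt sub; rewrite /P disj_sym // setIC.
have P_uniq (m t u : nat) : m \in ms0 -> t \in ms0 -> u \in ms0 ->
    P m t -> P m u -> t = u.
  rewrite !ms0P => /andP[m15 _] /andP[t15 _] /andP[u15 _] /andP[mt mtl] /andP[mu mul].
  exact: tline_meet_uniq lL (lt _ m15) m15 t15 u15 mt mu mtl mul.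
have P_ex (m : nat) : m \in ms0 -> has (P m) ms0.
  move=> mm; have := mm; rewrite ms0P => /andP[m15 m01].
  have [y yl ym] := meet_ex lL (tline_line vH m15).
  have yq : y != q by apply: contraNneq (pnt01_out mm q01) => <-.
  have yS : y \notin S.
    apply: contraL yq => yS; rewrite negbK.
    have /eqP/cards1P[z ez] := l1.
    have : y \in l :&: S by rewrite inE yl.
    have : q \in l :&: S by rewrite inE ql.
    by rewrite ez => /set1P-> /set1P->.
  have [t [t15 _ mt yt]] := tline_partner m15 ym yS.
  (* Otherwise the 3-secant of [t] would join [q] and [y], and so be [l]. *)
  have t01 : (0, 1) \notin nth [::] pms t.
    apply: contra (lt t t15) => /(tline_pnt vH t15); rewrite eq sub1set => qt.
    by apply/eqP; apply: join_inj yq lL (tline_line vH t15) yl ql yt qt.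
  apply/hasP; exists t; first by rewrite ms0P t15.
  have [z [_ ez _]] := tline_meet m15 t15 mt.
  have : y \in tline H m :&: tline H t by rewrite inE ym.
  by rewrite /P mt ez => /set1P <-; rewrite sub1set.
pose f (m : nat) := nth 0 ms0 (find (P m) ms0).
have fm (m : nat) : m \in ms0 -> f m \in ms0 by move/P_ex=> h; rewrite mem_nth -?has_find.
have Pf (m : nat) : m \in ms0 -> P m (f m) by move/P_ex=> h; apply: nth_find.
have f_neq (m : nat) : m \in ms0 -> f m != m.
  move=> mm; have /andP[+ _] := Pf m mm; rewrite eq_sym; apply: disj_neq.
  by move: mm; rewrite ms0P => /andP[].
have [//||m mm|B BE [B1 B2]] := @enum_blocks_ex f 6 ms0; first by vm_compute.
  split; [exact: fm | | exact: f_neq | by case/andP: (Pf m mm)].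
  apply: (P_uniq (f m)); rewrite ?fm //; first exact: Pf (fm m mm).
  exact: P_sym (Pf m mm).
exists B; split; first by rewrite blocks0E.
  rewrite -(cidx_nth c36 e ltab).
  have -> : b = f a; last exact: B1.
  apply: (P_uniq a); rewrite ?fm //; last exact: Pf.
  by rewrite /P ab ex sub1set.
exists l; split=> // d /B2[m mm ->]; have /andP[mf sub] := Pf m mm.
by rewrite hexpt_cidx // cidx_lt36 // fm.
Qed.

(** Both lines join the vertex {0,1} to the same hexagon point, hence coincide, and a line
    determines its block. *)
Lemma real_disjoint b b' c : b \in blocks0 -> b' \in blocks0 -> real H b -> real H b' ->
  c \in b -> c \in b' -> b = b'.
Proof.
move=> bb bb' [l [lL l01 lb]] [l' [lL' l01' lb']] cb cb'.
have c36 := blocks0_range bb cb.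
have [q qS eq] := pnt_meet vH (isT : 0 < 6) (isT : 1 < 6) isT.
have [x xS ex] := hexpt_ex c36.
have ell : l = l'.
  have := lb c cb; have := lb' c cb'.
  move: l01 l01'; rewrite eq ex !sub1set => ql ql' xl' xl.
  by apply: (join_inj _ lL lL' ql xl ql' xl'); apply: contraNneq xS => <-.
rewrite -{l' lL' l01'}ell in lb'; rewrite blocks0E in bb bb'.
apply: (enum_blocks_inj bb bb') => i j k im jm km ij ik jb kb.
have lc := lb _ jb; rewrite hexpt_cidx ?cidx_lt36 // in lc.
have lc' := lb' _ kb; rewrite hexpt_cidx ?cidx_lt36 // in lc'.
move: im jm km; rewrite !ms0P => /andP[i15 _] /andP[j15 _] /andP[k15 _].
apply: (tline_meet_uniq lL _ i15 j15 k15 ij ik lc lc').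
exact: block_line_tline lL l01 c36 (lb c cb) i15.
Qed.

End Hexagons.

(** * Effect of relabelling the heavy lines *)

Lemma perm6_lt k i : perm_eq k id6 -> i < 6 -> nth 0 k i < 6.
Proof.
move=> k6 i6; have : nth 0 k i \in id6.
  by rewrite -(perm_mem k6) mem_nth // (perm_size k6).
by rewrite mem_iota.
Qed.

Lemma nth_act H k i : perm_eq k id6 -> i < 6 ->
  nth set0 (act H k) i = nth set0 H (nth 0 k i).
Proof. by move=> k6 i6; rewrite (nth_map 0) // (perm_size k6). Qed.

Lemma act1 H : valid H -> act H id6 = H.
Proof. by case=> sz _ _; rewrite -{2}(mkseq_nth set0 H) sz. Qed.

Lemma actM H h k : valid H -> perm_eq h id6 -> perm_eq k id6 ->
  act (act H h) k = act H (comp h k).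
Proof.
move=> _ h6 k6; rewrite {1 3}/act -map_comp; apply/eq_in_map => i.
by rewrite (perm_mem k6) mem_iota /= => i6; rewrite nth_act.
Qed.

Lemma valid_act H k : valid H -> perm_eq k id6 -> valid (act H k).
Proof.
move=> vH k6; have [sz u sub] := vH; split.
- by rewrite size_map (perm_size k6).
- rewrite map_inj_in_uniq ?(perm_uniq k6) // => i j.
  by rewrite !(perm_mem k6) !mem_iota; apply: nth_inj.
- move=> l /mapP[i + ->]; rewrite (perm_mem k6) mem_iota => i6.
  by apply/sub/mem_nth; rewrite sz.
Qed.

Lemma pnt_act H k p : perm_eq k id6 -> p.1 < 6 -> p.2 < 6 ->
  pnt (act H k) p = pnt H (nth 0 k p.1, nth 0 k p.2).
Proof. by move=> k6 p1 p2; rewrite /pnt !nth_act. Qed.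

(** Both lines pass through two distinct points of the relabelled matching. *)
Lemma tline_act H k t : valid H -> perm_eq k id6 -> t < 15 ->
  mimg k (nth [::] pms t) < 15 ->
  tline (act H k) t = tline H (mimg k (nth [::] pms t)).
Proof.
move=> vH k6 t15 m15; have vHk := valid_act vH k6.
have sub r : r \in nth [::] pms t ->
    pnt (act H k) r \subset tline H (mimg k (nth [::] pms t)).
  move=> rt; have [_ r1 r2] := pms_range rt; rewrite pnt_act //.
  have [rm|rm] := mimgP t15 m15 rt; first exact: (tline_pnt vH m15 rm).
  by have := tline_pnt vH m15 rm; rewrite /pnt setIC.
have [p [q [pm qm pq lL [pl ql]]]] := tlineP vHk t15.
have [p12 p1 p2] := pms_range pm; have [q12 q1 q2] := pms_range qm.
have [x xS ex] := pnt_meet vHk p1 p2 (ltn_neq p12).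
have [y yS ey] := pnt_meet vHk q1 q2 (ltn_neq q12).
rewrite -!surjective_pairing in ex ey.
have xy : x != y by apply: (pms_pnt_neq vHk pm qm pq); rewrite ?ex ?ey set11.
have := sub p pm; have := sub q qm; move: pl ql; rewrite ex ey !sub1set.
by move=> xl yl yl' xl'; apply: (join_inj xy lL (tline_line vH m15)).
Qed.

Lemma hexpt_act H k c : valid H -> perm_eq k id6 -> c < 36 -> nth 36 (cmap k) c < 36 ->
  hexpt (act H k) c = hexpt H (nth 36 (cmap k) c).
Proof.
move=> vH k6 c36 kc; have [a [b [e a15 b15 [ma mb] ec]]] := cmap_nth c36 kc.
by rewrite ec hexpt_cidx -?ec // /hexpt e /= !tline_act.
Qed.

(** Two common hexagon points make the two lines equal. That line would contain two vertices of [S],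
    against [block_line_single]. *)
Lemma real_compat H k b b' c1 c2 : valid H -> perm_eq k id6 -> moves01 k ->
  b \in blocks0 -> b' \in blocks0 -> real (act H k) b -> real H b' ->
  c1 \in b -> c2 \in b -> c1 != c2 ->
  nth 36 (cmap k) c1 \in b' -> nth 36 (cmap k) c2 \in b' -> False.
Proof.
move=> vH k6 k01 bb bb' [l [lL l01 lb]] [l' [lL' l01' lb']] cb1 cb2 c12 cb1' cb2'.
have vHk := valid_act vH k6.
have E c : c \in b -> nth 36 (cmap k) c \in b' ->
    c < 36 /\ hexpt (act H k) c \subset l'.
  move=> cb cb'; have c36 := blocks0_range bb cb; split=> //.
  by rewrite hexpt_act ?lb' //; apply: blocks0_range bb' cb'.
have [c36 cl1] := E _ cb1 cb1'; have [d36 cl2] := E _ cb2 cb2'.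
have [x xS ex] := hexpt_ex vHk c36; have [y yS ey] := hexpt_ex vHk d36.
have xy : x != y.
  apply: contraNneq c12 => e; apply/eqP; apply: (hexpt_inj vHk (x := x)) => //.
    by rewrite ex set11.
  by rewrite ey e set11.
have ell : l = l'.
  move: cl1 cl2 (lb _ cb1) (lb _ cb2); rewrite ex ey !sub1set => xl' yl' xl yl.
  exact: join_inj xy lL lL' xl yl xl' yl'.
have l1 := block_line_single vHk lL l01 c36 (lb _ cb1).
have [k0 k1] : nth 0 k 0 < 6 /\ nth 0 k 1 < 6 by split; apply: perm6_lt.
have k0k1 : nth 0 k 0 != nth 0 k 1.
  by rewrite nth_uniq ?(perm_size k6) ?(perm_uniq k6).
have [p pS ep] := pnt_meet vH k0 k1 k0k1.
have [q qS eq] := pnt_meet vH (isT : 0 < 6) (isT : 1 < 6) isT.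
have pq : p != q.
  apply: (pnt_neq vH k0 k1 (isT : 0 < 6) (isT : 1 < 6) k0k1 isT k01).
    by rewrite ep set11.
  by rewrite eq set11.
rewrite -ell eq sub1set in l01'; rewrite pnt_act //= ep sub1set in l01.
have : 1 < #|l :&: S| by apply/card_gt1P; exists p, q; rewrite !inE l01 l01' pS qS.
by rewrite l1.
Qed.

Lemma real_sym H k b b' : valid H -> perm_eq k id6 -> ~~ moves01 k ->
  b \in blocks0 -> b' \in blocks0 -> real H b' ->
  (forall c, c \in b -> nth 36 (cmap k) c \in b') -> real (act H k) b.
Proof.
move=> vH k6 k01 bb bb' [l [lL l01 lb]] hb; exists l; split=> //.
  rewrite pnt_act //=; move: k01; rewrite negbK; move: (nth 0 k 0) (nth 0 k 1) => i j ij.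
  have := perm_mem ij i; rewrite !inE eqxx /= => /esym/orP i01.
  have := perm_mem ij j; rewrite !inE eqxx orbT => /esym/orP j01.
  have := perm_uniq ij; rewrite /= !inE andbT => nij.
  case: i01 nij => /eqP->; case: j01 => /eqP-> // _.
  by rewrite /pnt setIC.
move=> c cb; rewrite hexpt_act ?lb ?hb //; first exact: blocks0_range bb cb.
exact: blocks0_range bb' (hb c cb).
Qed.

Lemma valid_ex : exists H, valid H.
Proof.
exists (enum heavy); split.
- by rewrite -cardE card_heavy.
- exact: enum_uniq.
- by move=> l; rewrite mem_enum.
Qed.

Lemma no_odd_15set : False.
Proof.
have [H vH] := valid_ex; apply: (no_realization act1 actM valid_act real_cover
  real_disjoint real_compat real_sym refute_true vH).
Qed.

End OddSet.

(** * Code words *)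

Section Code.

Import GRing.Theory.
Local Open Scope ring_scope.

Lemma F2_neq0 (x : 'F_2) : x = (x != 0)%:R.
Proof. by case: x => -[|[|//]] ?; apply: val_inj. Qed.

Lemma F2_odd n : n%:R = (odd n)%:R :> 'F_2.
Proof.
by rewrite -{1}(odd_double_half n) natrD -mul2n natrM pchar_Zp // mul0r addr0.
Qed.

Variables (n : nat) (Pi : projective_plane n) (a b : nat) (M : 'M['F_2]_(a, b)).
Variables (l : 'I_a -> {set plane_point Pi}) (p : 'I_b -> plane_point Pi).
Hypothesis even_n : ~~ odd n.
Hypothesis l_lines : forall i, l i \in plane_lines Pi.
Hypothesis p_bij : bijective p.
Hypothesis M_incidence : forall i j, M i j = (p j \in l i)%:R.

Definition point_support (v : 'rV['F_2]_b) : {set plane_point Pi} :=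
  [set p j | j in [set j | v 0 j != 0]].

Lemma card_point_support (v : 'rV_b) : #|point_support v| = weight v.
Proof. by rewrite card_imset //; apply: bij_inj. Qed.

Lemma sum_support (v : 'rV_b) (A : {set plane_point Pi}) :
  \sum_j v 0 j * (p j \in A)%:R = #|A :&: point_support v|%:R.
Proof.
rewrite -sum1_card natr_sum [RHS]big_mkcond [RHS](reindex p) /=; last exact: onW_bij.
apply: eq_bigr => j _; rewrite inE (mem_imset _ _ (bij_inj p_bij)) inE.
by rewrite {1}[v 0 j]F2_neq0 -natrM mulnb andbC; case: (_ && _).
Qed.

Lemma line_meet_odd i k : odd #|l i :&: l k|.
Proof.
have [<-|ne] := eqVneq (l i) (l k).
  by rewrite setIid (plane_card_line (l_lines i)) /= even_n.
have [x [xi xu]] := plane_meet (l_lines i) (l_lines k) ne.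
have -> : l i :&: l k = [set x]; last by rewrite cards1.
by apply/setP=> y; rewrite [RHS]inE; apply/idP/eqP => [/xu|->].
Qed.

(** If [v] is the combination of rows with coefficients [D], the intersection size is the sum of D_i
    |A /\ l_i| modulo 2, which is the sum of the D_i for every admissible [A]. *)
Lemma codeword_sum (v : 'rV_b) : v \in code M ->
  exists t : 'F_2, forall A : {set plane_point Pi}, (forall i, odd #|A :&: l i|) -> #|A :&: point_support v|%:R = t.
Proof.
rewrite inE => /submxP[D ->]; exists (\sum_i D 0 i) => A oddA.
rewrite -sum_support; under eq_bigr do rewrite mxE mulr_suml.
rewrite exchange_big /=; apply: eq_bigr => i _.
under eq_bigr do rewrite -mulrA M_incidence -natrM mulnb.
rewrite -mulr_sumr -natr_sum.
have -> : (\sum_j ((p j \in l i) && (p j \in A)) = #|A :&: l i|)%N.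
  rewrite -sum1_card [RHS]big_mkcond [RHS](reindex p) /=; last exact: onW_bij.
  by apply: eq_bigr => j _; rewrite inE andbC; case: (_ && _).
by rewrite F2_odd oddA mulr1.
Qed.

(** [codeword_sum] compares the whole plane with the line [l k]; both meet all lines oddly because
    [n.+1] is odd and distinct lines share one point. *)
Lemma codeword_odd (v : 'rV_b) k : v \in code M -> odd (weight v) ->
  odd #|l k :&: point_support v|.
Proof.
case/codeword_sum=> t ht; rewrite -card_point_support => oddv.
have := ht [set: _]; rewrite setTI => /(_ _); rewrite F2_odd oddv => ht1.
have : #|l k :&: point_support v|%:R = 1%:R :> 'F_2.
  rewrite ht => [|i]; last exact: line_meet_odd.
  rewrite -ht1 // => i.
  by rewrite setTI (plane_card_line (l_lines i)) /= even_n.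
by rewrite F2_odd; case: (odd _).
Qed.

End Code.

Theorem mainTheorem1 (Pi : projective_plane 10) (M : 'M['F_2]_(111, 111))
    (hM : incidence_matrix Pi M) : weight_count (code M) 15 = 0%N.
Proof.
have [l [p [l_inj l_lines p_bij hMij]]] := hM.
have lL i : l i \in plane_lines Pi by rewrite -l_lines imset_f.
have card_L : #|plane_lines Pi| = 111 by rewrite -l_lines card_imset // card_ord.
apply/eqP; rewrite cards_eq0 -subset0; apply/subsetP => v.
rewrite inE => /andP[vC /eqP w15].
have odd_S m : m \in plane_lines Pi -> odd #|m :&: point_support p v|.
  rewrite -l_lines => /imsetP[i _ ->].
  by apply: (codeword_odd _ lL p_bij hMij) => //; rewrite w15.
by case: (no_odd_15set _ odd_S card_L); rewrite card_point_support.
Qed.
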